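(* Let $T\ge1$, let $\mathbf{Y}_T\in\mathbb{R}^{T\cdot p}$ be the stacked vector of outputs $y_1,\dots,y_T$, with $\mathbf{Y}_T\sim\mathcal{N}(M_i,S_i)$ under $H_i$, $i\in\{0,1\}$ ($M_i,S_i$ as given in the context, $S_0,S_1$ invertible). Let $L_i(\mathbf{Y}_T)$ be the likelihood of $\mathbf{Y}_T$ under $H_i$. Then the log-likelihood ratio $LLR=\log L_1(\mathbf{Y}_T)-\log L_0(\mathbf{Y}_T)$ follows a generalized chi-squared distribution, expressed as a linear combination of independent non-central chi-squared variables and a standard normal random variable (plus a constant): $$LLR\mid H_0\sim\sum_{j\in\mathcal{K}_0}w_j\,\chi^2_1(\nu_j^2)+\sigma_0Z_0+C_0,\qquad LLR\mid H_1\sim\sum_{j\in\mathcal{K}_1}\bar w_j\,\chi^2_1(\bar\nu_j^2)+\sigma_1Z_1+C_1,$$ where $Z_0,Z_1\sim\mathcal{N}(0,1)$, all random variables within each sum are independent, and the parameters are as follows. Let $D=M_1-M_0$, and take eigenvalue decompositions $$\Phi_0=S_0^{1/2}S_1^{-1}S_0^{1/2}=\Psi_0\Lambda\Psi_0^\top,\qquad \Phi_1=S_1^{1/2}S_0^{-1}S_1^{1/2}=\Psi_1\bar\Lambda\Psi_1^\top,$$ with $\Psi_0,\Psi_1\in\mathbb{R}^{(T\cdot p)\times(T\cdot p)}$ orthogonal (columns being eigenvectors) and $\Lambda,\bar\Lambda$ diagonal with diagonal entries (eigenvalues) $\lambda_j,\bar\lambda_j$. Set $$w_j=\frac{1-\lambda_j}{2},\quad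 \bar w_j=\frac{\bar\lambda_j-1}{2},\quad \mathcal{K}_0=\{j: w_j\ne0\},\quad \mathcal{K}_1=\{j:\bar w_j\neq0\},$$ $$b_0=\Psi_0^\top S_0^{1/2}S_1^{-1}D,\quad b_1=\Psi_1^\top S_1^{1/2}S_0^{-1}D,\quad \nu_j=\frac{b_{0,j}}{2w_j}\ (j\in\mathcal{K}_0),\quad \bar\nu_j=\frac{b_{1,j}}{2\bar w_j}\ (j\in\mathcal{K}_1),$$ $$\sigma_0^2=\sum_{j\notin\mathcal{K}_0}b_{0,j}^2,\quad \sigma_1^2=\sum_{j\notin\mathcal{K}_1}b_{1,j}^2,$$ $$C_0=\tfrac12\Big(\log\frac{|S_0|}{|S_1|}-D^\top S_1^{-1}D\Big)-\sum_{j\in\mathcal{K}_0}w_j\nu_j^2,\qquad C_1=\tfrac12\Big(\log\frac{|S_0|}{|S_1|}+D^\top S_0^{-1}D\Big)-\sum_{j\in\mathcal{K}_1}\bar w_j\bar\nu_j^2.$$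
   Context: System: $x_{k+1}=Ax_k+Bu_k+w_k$, $y_k=Cx_k+\epsilon_k$, with $x_k\in\mathbb{R}^n$, $y_k\in\mathbb{R}^p$, $u_k\in\mathbb{R}^q$, $A\in\mathbb{R}^{n\times n}$, $B\in\mathbb{R}^{n\times q}$, $C\in\mathbb{R}^{p\times n}$. The process noise $w_k\sim\mathcal{N}(\mu_w,\Sigma_w)$ is i.i.d., the measurement noise $\epsilon_k\sim\mathcal{N}(0,\Sigma_e)$ is i.i.d., and $x_0\sim\mathcal{N}(\mu_0,\Sigma_0)$, with positive semidefinite covariances; $x_0$, $w_t$, $\epsilon_t$ (all $t$) are independent. $H_i$ ($i\in\{0,1\}$) is the distribution of the outputs when $u_k=K_ix_k$, where $K_0,K_1\in\mathbb{R}^{q\times n}$ and $A+BK_0$, $A+BK_1$ are Schur stable. Under $H_i$, $\mathbf{Y}_T\sim\mathcal{N}(M_i,S_i)$ with $M_i=U_i\boldsymbol{\mu}_W+V_i\mu_0$ and $S_i=U_i\mathbf{\Sigma}_WU_i^\top+V_i\Sigma_0V_i^\top+\mathbf{\Sigma}_E$. Here $U_i\in\mathbb{R}^{(T\cdot p)\times(T\cdot n)}$ is the block lower triangular matrix whose $(s,t)$ block ($1\le s,t\le T$, blocks of size $p\times n$) is $C(A+BK_i)^{s-t}$ for $t\le s$ and $0$ for $t>s$; $V_i\in\mathbb{R}^{(T\cdot p)\times n}$ has $s$-th block row $C(A+BK_i)^s$, $s=1,\dots,T$; $\boldsymbol{\mu}_W\in\mathbb{R}^{T\cdot n}$ stacks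 $\mu_w$ $T$ times; $\mathbf{\Sigma}_W$ and $\mathbf{\Sigma}_E$ are block diagonal with $T$ diagonal blocks equal to $\Sigma_w$ and $\Sigma_e$ respectively. Notation: $\chi^2_1(\nu^2)$ is a non-central chi-squared variable with one degree of freedom and non-centrality parameter $\nu^2$, i.e. the law of $(Z+\nu)^2$ with $Z\sim\mathcal{N}(0,1)$; $|S|$ is the determinant; $S^{1/2}$ is the symmetric positive semidefinite square root; $b_{i,j}$ is the $j$-th entry of $b_i$; $\sigma_i\ge0$; the likelihood is the probability density. *)

(* Defs.v *)
From HB Require Import structures.
From mathcomp Require Import all_boot all_order all_algebra.
From mathcomp Require Import complex.
From mathcomp Require Import all_classical all_reals all_analysis.

Set Implicit Arguments.
Unset Strict Implicit.
Unset Printing Implicit Defensive.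

Import Order.TTheory GRing.Theory Num.Theory.
Import numFieldNormedType.Exports.

Local Open Scope classical_set_scope.
Local Open Scope ring_scope.

(* 'M[T]_(m, n) carries the product sigma-algebra (generated by the entries);
   on 'cV[R]_n this is the Borel sigma-algebra of R^n. *)
Definition measure_matrix_display : measure_display -> measure_display.
Proof. exact. Qed.

Section measurable_matrix.
Context {d} {T : measurableType d}.
Variables m n : nat.

Definition matrix_measurable : set (set 'M[T]_(m, n)) :=
  <<s \bigcup_(ij in [set: 'I_m * 'I_n])
        preimage_set_system setT (fun A : 'M[T]_(m, n) => A ij.1 ij.2)
          measurable >>.

Let matrix_set0 : matrix_measurable set0.
Proof. exact: sigma_algebra0. Qed.

Let matrix_setC A : matrix_measurable A -> matrix_measurable (~` A).
Proof. exact: sigma_algebraC. Qed.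

Let matrix_bigcup (F : (set 'M[T]_(m, n))^nat) :
  (forall i, matrix_measurable (F i)) -> matrix_measurable (\bigcup_i (F i)).
Proof. exact: sigma_algebra_bigcup. Qed.

HB.instance Definition _ := @isMeasurable.Build (measure_matrix_display d)
  'M[T]_(m, n) matrix_measurable matrix_set0 matrix_setC matrix_bigcup.

End measurable_matrix.

(* n-fold product on R^n of a measure mu on R, built by integrating the
   measure of sections, as in the binary product \x of the library. *)
Fixpoint product_power (R : realType) (mu : set R -> \bar R) (n : nat) :
    set 'cV[R]_n -> \bar R :=
  match n return set 'cV[R]_n -> \bar R with
  | 0 => fun A => \d_(0 : 'cV[R]_0) A
  | n'.+1 => fun A => (\int[mu]_x
      product_power mu [set v : 'cV[R]_n' |
        A (col_mx (x%:M : 'cV[R]_1) v : 'cV[R]_(1 + n'))])%E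
  end.
Arguments product_power {R} mu n A.

Definition lebesgue_cV (R : realType) (n : nat) : set 'cV[R]_n -> \bar R :=
  product_power lebesgue_measure n.
Arguments lebesgue_cV {R n}.

Definition std_normal_cV (R : realType) (n : nat) : set 'cV[R]_n -> \bar R :=
  product_power (normal_prob 0 1) n.
Arguments std_normal_cV {R n}.

Section matrices.
Context {R : realType}.

Definition psdmx (n : nat) (S : 'M[R]_n) : Prop :=
  S^T = S /\ forall v : 'cV[R]_n, 0 <= (v^T *m S *m v) 0 0.

(* Q = S^{1/2} *)
Definition psd_sqrt_of (n : nat) (S Q : 'M[R]_n) : Prop :=
  psdmx Q /\ Q *m Q = S.

Definition orthogonalmx (n : nat) (Q : 'M[R]_n) : Prop := Q^T *m Q = 1%:M.

Definition eigendecomposition (n : nat) (Phi Psi : 'M[R]_n) (lam : 'rV[R]_n) :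
    Prop :=
  orthogonalmx Psi /\ Phi = Psi *m diag_mx lam *m Psi^T.

Definition schur_stable (n : nat) (F : 'M[R]_n) : Prop :=
  forall z : R[i], eigenvalue (map_mx (real_complex R) F) z -> `|z| < 1.

End matrices.

Section probability.
Context {d} {Omega : measurableType d} {R : realType}.
Variable P : probability Omega R.

Definition mutually_independent (I : choiceType) (F : I -> set (set Omega)) :
    Prop :=
  forall (s : seq I) (E : I -> set Omega), uniq s ->
    (forall i, i \in s -> F i (E i)) ->
    P (\bigcap_(i in [set` s]) E i) = (\prod_(i <- s) P (E i))%E.

Definition sigma_rv d' (T : measurableType d') (X : Omega -> T) :
    set (set Omega) :=
  preimage_set_system setT X measurable.

(* X ~ N(mu, Sigma): X has the law of mu + G Z, where Z has i.i.d. standard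
   normal entries and G G^T = Sigma; Sigma may be singular. *)
Definition mvnormal (n : nat) (X : Omega -> 'cV[R]_n) (mu : 'cV[R]_n)
    (Sigma : 'M[R]_n) : Prop :=
  exists2 G : 'M[R]_n, G *m G^T = Sigma &
    forall A : set 'cV[R]_n, measurable A ->
      P (X @^-1` A) = std_normal_cV [set z | A (mu + G *m z)].

Definition density_of (n : nat) (X : Omega -> 'cV[R]_n) (f : 'cV[R]_n -> R) :
    Prop :=
  [/\ measurable_fun setT f, (forall y, 0 <= f y) &
    forall A : set 'cV[R]_n, measurable A ->
      P (X @^-1` A) = (\int[lebesgue_cV]_(y in A) (f y)%:E)%E].

(* X ~ chi^2_1(nu^2), the law of (Z + nu)^2 with Z ~ N(0, 1) *)
Definition nc_chi2_1 (X : Omega -> R) (nu : R) : Prop :=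
  forall A : set R, measurable A ->
    P (X @^-1` A) = normal_prob 0 1 [set z | A ((z + nu) ^+ 2)].

Definition std_normal (X : Omega -> R) : Prop :=
  forall A : set R, measurable A -> P (X @^-1` A) = normal_prob 0 1 A.

End probability.

Section generalized_chi2.
Context {R : realType} {N : nat}.

(* Under P, X follows the law of
     \sum_(j in K) w_j chi^2_1(nu_j^2) + sigma Z + C
   with all the random variables of the sum mutually independent; they may be
   taken on another probability space (Omega', P'). *)
Definition generalized_chi2 d (Omega : measurableType d)
    (P : probability Omega R) (X : Omega -> R)
    (K : {set 'I_N}) (w nu : 'I_N -> R) (sigma C : R) : Prop :=
  exists (d' : measure_display) (Omega' : measurableType d')
    (P' : probability Omega' R)
    (Q : 'I_N -> {RV P' >-> R}) (Z : {RV P' >-> R}),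
  [/\ (forall j, j \in K -> nc_chi2_1 P' (Q j) (nu j)),
      std_normal P' Z,
      mutually_independent P' (fun k : option {j : 'I_N | j \in K} =>
        if k is Some j then sigma_rv (Q (val j)) else sigma_rv Z) &
      forall A : set R, measurable A ->
        P (X @^-1` A) =
        P' [set t | A (\sum_(j in K) w j * Q j t + sigma * Z t + C)]].

End generalized_chi2.

Section closed_loop_system.
Context {R : realType} {n p q : nat}.

(* Instantiated with two probability measures carrying the same processes and
   two gains K, so the equations, the feedback law in particular, can only be
   required almost surely. *)
Record closed_loop d (Omega : measurableType d) (P : probability Omega R)
    (x : nat -> {mfun Omega >-> 'cV[R]_n}) (u : nat -> {mfun Omega >-> 'cV[R]_q})
    (y : nat -> {mfun Omega >-> 'cV[R]_p})
    (w : nat -> {mfun Omega >-> 'cV[R]_n}) (eps : nat -> {mfun Omega >-> 'cV[R]_p})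
    (A : 'M[R]_n) (B : 'M[R]_(n, q)) (C : 'M[R]_(p, n)) (K : 'M[R]_(q, n))
    (mu_w : 'cV[R]_n) (Sigma_w : 'M[R]_n) (Sigma_e : 'M[R]_p)
    (mu_0 : 'cV[R]_n) (Sigma_0 : 'M[R]_n) : Prop := {
  closed_loop_state : {ae P, forall t, forall k,
    x k.+1 t = A *m x k t + B *m u k t + w k t};
  closed_loop_output : {ae P, forall t, forall k,
    y k t = C *m x k t + eps k t};
  closed_loop_feedback : {ae P, forall t, forall k, u k t = K *m x k t};
  closed_loop_w : forall k, mvnormal P (w k) mu_w Sigma_w;
  closed_loop_eps : forall k, mvnormal P (eps k) 0 Sigma_e;
  closed_loop_x0 : mvnormal P (x 0%N) mu_0 Sigma_0;
  closed_loop_indep : mutually_independent P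
    (fun i : option (nat + nat) => match i with
      | None => sigma_rv (x 0%N)
      | Some (inl k) => sigma_rv (w k)
      | Some (inr k) => sigma_rv (eps k)
      end)
}.

(* In the block matrices below the 0-based indices s, t < T stand for the
   block indices s.+1, t.+1, and F = A + B K_i; R^{T p} is represented with
   dimension \sum_(s < T) p. *)
Definition outU (T : nat) (C : 'M[R]_(p, n)) (F : 'M[R]_n) :
    'M[R]_(\sum_(s < T) p, \sum_(t < T) n) :=
  \mxblock_(s < T, t < T) (if (t <= s)%N then C *m F ^+ (s - t) else 0).

Definition outV (T : nat) (C : 'M[R]_(p, n)) (F : 'M[R]_n) :
    'M[R]_(\sum_(s < T) p, n) :=
  \mxcol_(s < T) (C *m F ^+ s.+1).

Definition out_mean (T : nat) (C : 'M[R]_(p, n)) (F : 'M[R]_n)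
    (mu_w mu_0 : 'cV[R]_n) : 'cV[R]_(\sum_(s < T) p) :=
  outU T C F *m (\mxcol_(t < T) mu_w) + outV T C F *m mu_0.

Definition out_cov (T : nat) (C : 'M[R]_(p, n)) (F : 'M[R]_n)
    (Sigma_w Sigma_0 : 'M[R]_n) (Sigma_e : 'M[R]_p) :
    'M[R]_(\sum_(s < T) p) :=
  outU T C F *m (\mxdiag_(t < T) Sigma_w) *m (outU T C F)^T
  + outV T C F *m Sigma_0 *m (outV T C F)^T
  + \mxdiag_(s < T) Sigma_e.

Definition stacked_outputs (Omega : Type) (T : nat)
    (y : nat -> Omega -> 'cV[R]_p) (t : Omega) : 'cV[R]_(\sum_(s < T) p) :=
  \mxcol_(s < T) y s.+1 t.

End closed_loop_system.

(* Main.v *)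
(* The laws N(M0, S0) and N(M1, S1) are diagonalized simultaneously: with
   W = S0^{1/2} Psi0, the map z |-> M0 + W z carries the standard normal law
   gamma to N(M0, S0), and the law of c + Lambda^{-1/2} z to N(M1, S1), where
   c = W^{-1} D. The second of these has an explicit product density r > 0
   relative to gamma. By uniqueness of densities L1 = r L0 almost everywhere in
   the new coordinate z, so that LLR = log r under H0, which is a quadratic
   polynomial in z with diagonal quadratic part; completing the squares gives
   the chi-squared terms, and a reflection merges the linear terms of index
   outside K0 into a single normal variable. H1 follows by exchanging the roles
   of the two laws. No change of variables for Lebesgue measure in R^n is
   needed: only the rotation invariance of gamma, which is deduced from its
   Cameron-Martin formula. *)
Require Import Defs.
From HB Require Import structures.
From mathcomp Require Import all_boot all_order all_algebra.
From mathcomp Require Import complex.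
From mathcomp Require Import all_classical all_reals all_analysis.
From mathcomp Require Import measurable_realfun.
From mathcomp Require Import ring lra.

Set Implicit Arguments.
Unset Strict Implicit.
Unset Printing Implicit Defensive.

Import Order.TTheory GRing.Theory Num.Theory.
Import numFieldNormedType.Exports.

Local Open Scope ring_scope.

Local Open Scope classical_set_scope.

(** * Measurability of matrix-valued maps and of matrix operations *)

Lemma measurable_coord {d} {T : measurableType d} {m n : nat} i j :
  measurable_fun setT (fun A : 'M[T]_(m, n) => A i j).
Proof.
move=> _ B mB; rewrite setTI; apply: sub_sigma_algebra.
by exists (i, j) => //; exists B => //; rewrite setTI.
Qed.

Lemma measurable_matrix {d d'} {X : measurableType d'} {T : measurableType d}
    {m n : nat} (D : set X) (f : X -> 'M[T]_(m, n)) :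
  (forall i j, measurable_fun D (fun x => f x i j)) -> measurable_fun D f.
Proof.
move=> mf mD; move: (mD); apply: measurability; first by [].
move=> _ [_ [[i j] _ [B mB <-]] <-]; rewrite setTI.
exact: (mf i j mD B mB).
Qed.

Section measurable_matrix_operations.
Context {R : realType} {d} {X : measurableType d} (D : set X).

Lemma measurable_addmx {m n} (f g : X -> 'M[R]_(m, n)) :
  measurable_fun D f -> measurable_fun D g ->
  measurable_fun D (fun x => f x + g x).
Proof.
move=> mf mg; apply: measurable_matrix => i j.
under eq_fun do rewrite mxE.
apply: measurable_funD.
  exact: (measurableT_comp (measurable_coord i j) mf).
exact: (measurableT_comp (measurable_coord i j) mg).
Qed.

Lemma measurable_mulmx {m n p} (f : X -> 'M[R]_(m, n)) (g : X -> 'M[R]_(n, p)) :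
  measurable_fun D f -> measurable_fun D g ->
  measurable_fun D (fun x => f x *m g x).
Proof.
move=> mf mg; apply: measurable_matrix => i j.
under eq_fun do rewrite mxE.
apply: measurable_sum => k; apply: measurable_funM.
  exact: (measurableT_comp (measurable_coord i k) mf).
exact: (measurableT_comp (measurable_coord k j) mg).
Qed.

Lemma measurable_trmx {m n} (f : X -> 'M[R]_(m, n)) :
  measurable_fun D f -> measurable_fun D (fun x => (f x)^T).
Proof.
move=> mf; apply: measurable_matrix => i j; under eq_fun do rewrite mxE.
exact: (measurableT_comp (measurable_coord j i) mf).
Qed.

End measurable_matrix_operations.

(** * Splitting a vector into its head and its tail *)

Section cV_cons.
Context {R : realType} {n : nat}.

Definition cV_cons (xv : R * 'cV[R]_n) : 'cV[R]_n.+1 :=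
  col_mx (xv.1%:M : 'cV[R]_1) xv.2 : 'cV[R]_(1 + n).

Definition cV_uncons (v : 'cV[R]_n.+1) : R * 'cV[R]_n :=
  (v 0 0, dsubmx (v : 'cV[R]_(1 + n))).

Lemma cV_consK : cancel cV_cons cV_uncons.
Proof.
move=> [x v]; rewrite /cV_cons /cV_uncons /= col_mxKd; congr pair.
have -> : 0 = lshift n (0 : 'I_1) by apply/val_inj.
by apply: etrans (col_mxEu _ _ _ _) _; rewrite mxE eqxx mulr1n.
Qed.

Lemma cV_cons0 x v : cV_cons (x, v) 0 0 = x.
Proof. by have := cV_consK (x, v) => /(congr1 fst). Qed.

Lemma cV_consS x v i : cV_cons (x, v) (lift 0 i) 0 = v i 0.
Proof.
have -> : lift 0 i = rshift 1 i by apply/val_inj.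
exact: col_mxEd.
Qed.

Lemma cV_consE x v i : cV_cons (x, v) i 0 =
  if unlift 0 i is Some j then v j 0 else x.
Proof. by case: unliftP => [j ->|->]; rewrite ?cV_consS ?cV_cons0. Qed.

Lemma measurable_cV_cons : measurable_fun setT cV_cons.
Proof.
apply: measurable_matrix => i j; rewrite ord1.
rewrite (_ : (fun _ => _) = (fun xv : R * 'cV[R]_n =>
  if unlift 0 i is Some j then xv.2 j 0 else xv.1)); last first.
  by apply/funext => -[x v]; rewrite cV_consE.
case: unlift => [k|]; last exact: measurable_fst.
exact: (measurableT_comp (measurable_coord k 0) measurable_snd).
Qed.

Lemma measurable_cV_uncons : measurable_fun setT cV_uncons.
Proof.
apply/measurable_fun_pairP; split; first exact: measurable_coord.
apply: measurable_matrix => i j /=.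
rewrite (_ : (fun _ => _) = (fun v : 'cV[R]_n.+1 => v (lift 0 i) j)).
  exact: measurable_coord.
by apply/funext => v; rewrite /= mxE; congr (v _ _); apply/val_inj.
Qed.

End cV_cons.

(** * Product powers as sigma-finite measures, and iterated integration *)

Lemma pack_sigma_finite_measure {d} {T : measurableType d} {R : realType}
    (m : {measure set T -> \bar R}) : sigma_finite setT m ->
  {m' : {sigma_finite_measure set T -> \bar R} | m = m' :> (set T -> \bar R)}.
Proof.
move=> sf.
pose H1 := isSigmaFinite.Build _ _ _ _ sf.
pose H2 := isSFinite.Build _ _ _ _ (sfinite_measure_sigma_finite sf).
by exists (HB.pack_for (SigmaFiniteMeasure.type T R) (Measure.sort m) H1 H2).
Qed.

Section product_power_measure.
Context {R : realType} (mu : {sigma_finite_measure set R -> \bar R}).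

Lemma product_powerS n (A : set 'cV[R]_n.+1) : product_power mu n.+1 A =
  (\int[mu]_x product_power mu n [set v | A (cV_cons (x, v))])%E.
Proof. by []. Qed.

(** By induction, the power of order [n.+1] is the image of [mu \x nu] under [cV_cons]. The form is
    existential because the binary product needs the full measure structure at order [n] before the
    one at [n.+1] can be built. *)
Lemma product_power_sigma_finite_measure n :
  {nu : {sigma_finite_measure set 'cV[R]_n -> \bar R} |
    product_power mu n = nu}.
Proof.
elim: n => [|n [nu nuE]].
  exists (\d_(0 : 'cV[R]_0) : {sigma_finite_measure set 'cV[R]_0 -> \bar R}).
  by [].
pose pf := pushforward (mu \x nu)%E (@cV_cons R n) : {measure set _ -> \bar R}.
pose m := pf measurable_cV_cons.
have sf : sigma_finite setT m.
  have /sigma_finiteP[F [FT ndF Foo]] := sigma_finiteT mu.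
  have /sigma_finiteP[G [GT ndG Goo]] := sigma_finiteT nu.
  (* Both exhaustions increase, so the products with equal indices already cover the whole space. *)
  exists (fun k => cV_uncons @^-1` (F k `*` G k)).
    rewrite -preimage_bigcup; apply/esym/seteqP; split=> // v _.
    have [i _ Fi] : (\bigcup_i F i) (cV_uncons v).1 by rewrite -FT.
    have [j _ Gj] : (\bigcup_i G i) (cV_uncons v).2 by rewrite -GT.
    exists (maxn i j) => //; split.
      by move: Fi; exact/subsetPset/ndF/leq_maxl.
    by move: Gj; exact/subsetPset/ndG/leq_maxr.
  move=> k; have [mF F_oo] := Foo k; have [mG G_oo] := Goo k; split.
    rewrite -[X in measurable X]setTI; apply: measurable_cV_uncons => //.
    exact: measurableX.
  have -> : m (cV_uncons @^-1` (F k `*` G k)) = (mu \x nu)%E (F k `*` G k).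
    by congr product_measure1; apply/seteqP; split => xv;
      rewrite /preimage /mkset cV_consK.
  by rewrite product_measure1E// lte_mul_pinfty// ge0_fin_numE.
have [m' mE] := pack_sigma_finite_measure sf.
exists m'; rewrite -mE.
apply/funext => A; rewrite product_powerS /m /pf /pushforward /product_measure1.
apply: eq_integral => x _ /=; rewrite nuE; congr (nu _).
by apply/seteqP; split => v /=; rewrite /xsection /= inE.
Qed.

End product_power_measure.

Section product_power_measures.
Local Open Scope ereal_scope.

Section product_power_instances.
Context {R : realType} (mu : {sigma_finite_measure set R -> \bar R}) (n : nat).
Let nu := sval (product_power_sigma_finite_measure mu n).
Let nuE : product_power mu n = nu.
Proof. exact: (svalP (product_power_sigma_finite_measure mu n)). Qed.

Let pp0 : product_power mu n set0 = 0.
Proof. by rewrite nuE measure0. Qed.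

Let pp_ge0 A : 0 <= product_power mu n A.
Proof. by rewrite nuE measure_ge0. Qed.

Let pp_sigma_additive : semi_sigma_additive (product_power mu n).
Proof. by rewrite nuE; exact: measure_semi_sigma_additive. Qed.

HB.instance Definition _ := isMeasure.Build _ _ _ (product_power mu n)
  pp0 pp_ge0 pp_sigma_additive.

Let pp_sigma_finite : sigma_finite setT (product_power mu n).
Proof. by rewrite nuE; exact: sigma_finiteT. Qed.

HB.instance Definition _ := Measure_isSigmaFinite.Build _ _ _
  (product_power mu n) pp_sigma_finite.

End product_power_instances.

Lemma ge0_integral_product_powerS {R : realType}
    (mu : {sigma_finite_measure set R -> \bar R}) n (h : 'cV[R]_n.+1 -> \bar R) :
  measurable_fun setT h -> (forall v, 0 <= h v) ->
  \int[product_power mu n.+1]_v h v =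
  \int[mu]_x \int[product_power mu n]_v h (cV_cons (x, v)).
Proof.
move=> mh h0.
transitivity (\int[pushforward (mu \x product_power mu n) (@cV_cons R n)]_v h v).
  apply: eq_measure_integral; first exact: measurable_cV_cons.
  move=> mf A mA _; apply: etrans (product_powerS _ _) _.
  rewrite /= /pushforward /product_measure1.
  apply: eq_integral => x _ /=; congr (product_power mu n _).
  by apply/seteqP; split => v /=; rewrite /xsection /= inE.
rewrite ge0_integral_pushforward//=; last exact: measurable_cV_cons.
rewrite preimage_setT fubini_tonelli1//.
exact: (measurableT_comp mh measurable_cV_cons).
Qed.

(* lebesgue_measure and normal_prob are measures on measurableTypeR R, whose
   display is not the one of R as a measurableType *)
Section measures_on_R.
Context {R : realType}.

Definition lebesgue_R : set R -> \bar R := lebesgue_measure.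

Definition std_normal_R : set R -> \bar R := normal_prob 0 1.

Let lebesgue_R_sigma_additive : semi_sigma_additive lebesgue_R.
Proof. exact: (@measure_semi_sigma_additive _ _ _ (@lebesgue_measure R)). Qed.

HB.instance Definition _ := isMeasure.Build _ _ _ lebesgue_R
  (measure0 (@lebesgue_measure R)) (measure_ge0 (@lebesgue_measure R))
  lebesgue_R_sigma_additive.

Let lebesgue_R_sigma_finite : sigma_finite setT lebesgue_R.
Proof. exact: (sigma_finiteT (@lebesgue_measure R)). Qed.

HB.instance Definition _ := Measure_isSigmaFinite.Build _ _ _ lebesgue_R
  lebesgue_R_sigma_finite.

Let std_normal_R_sigma_additive : semi_sigma_additive std_normal_R.
Proof. exact: (@measure_semi_sigma_additive _ _ _ (@normal_prob R 0 1)). Qed.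

HB.instance Definition _ := isMeasure.Build _ _ _ std_normal_R
  (measure0 (@normal_prob R 0 1)) (measure_ge0 (@normal_prob R 0 1))
  std_normal_R_sigma_additive.

Let std_normal_R_setT : std_normal_R setT = 1.
Proof. exact: (probability_setT (@normal_prob R 0 1)). Qed.

HB.instance Definition _ := Measure_isProbability.Build _ _ R std_normal_R
  std_normal_R_setT.

Lemma ge0_integral_lebesgue_R (D : set R) (h : R -> \bar R) :
  measurable D -> measurable_fun D h -> (forall x, 0 <= h x) ->
  \int[lebesgue_R]_(x in D) h x = \int[lebesgue_measure]_(x in D) h x.
Proof.
move=> mD mh h0.
pose f : measurableTypeR R -> R := idfun.
have mf : measurable_fun setT f by move=> _ A mA; rewrite setTI.
transitivity (\int[pushforward (@lebesgue_measure R) f]_(x in D) h x).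
  by apply: eq_measure_integral.
by rewrite ge0_integral_pushforward.
Qed.

Lemma std_normal_RE A : measurable A ->
  std_normal_R A = \int[lebesgue_R]_(x in A) (normal_pdf 0 1 x)%:E.
Proof.
move=> mA; rewrite ge0_integral_lebesgue_R//.
  apply/measurable_EFinP; apply: measurable_funTS.
  exact: measurable_normal_pdf.
by move=> x; rewrite lee_fin normal_pdf_ge0.
Qed.

End measures_on_R.

Section std_normal_cV_instances.
Context {R : realType} (n : nat).

(** [lebesgue_R] is convertible to [lebesgue_measure], and [std_normal_R] to [normal_prob 0 1], so
    the structures on the product powers carry over as they stand. *)
HB.instance Definition _ := SigmaFiniteMeasure.copy (@lebesgue_cV R n)
  (product_power lebesgue_R n).

HB.instance Definition _ := Measure.copy (@std_normal_cV R n)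
  (product_power std_normal_R n).

Let std_normal_cV_setT : @std_normal_cV R n setT = 1.
Proof.
rewrite /std_normal_cV; elim: n => [|m IH]; first by rewrite /= diracT.
apply: etrans (product_powerS std_normal_R _) _.
rewrite [LHS](_ : _ = \int[std_normal_R]_x (cst 1 x)).
  by rewrite integral_cst// mul1e; exact: (@probability_setT _ _ _ std_normal_R).
by apply: eq_integral => x _; exact: IH.
Qed.

HB.instance Definition _ := Measure_isProbability.Build _ _ R
  (@std_normal_cV R n) std_normal_cV_setT.

End std_normal_cV_instances.

Lemma ge0_integral_std_normal_cVS {R : realType} n (h : 'cV[R]_n.+1 -> \bar R) :
  measurable_fun setT h -> (forall v, 0 <= h v) ->
  \int[std_normal_cV]_v h v =
  \int[std_normal_R]_x \int[std_normal_cV]_v h (cV_cons (x, v)).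
Proof.
move=> mh h0.
rewrite (@eq_measure_integral _ _ _ _ (product_power (@std_normal_R R) n.+1))//.
by rewrite ge0_integral_product_powerS.
Qed.

Lemma ge0_integral_std_normal_cV0 {R : realType} (h : 'cV[R]_0 -> \bar R) :
  measurable_fun setT h -> \int[std_normal_cV]_v h v = h 0%R.
Proof.
move=> mh.
rewrite (@eq_measure_integral _ _ _ _ (\d_(0%R : 'cV[R]_0)))//.
by rewrite integral_dirac// diracT mul1e.
Qed.

End product_power_measures.

(** * Integration against densities and affine changes of variable on the line *)

Section gaussian_density.
Local Open Scope ereal_scope.

Section integral_density.
Context {d} {T : measurableType d} {R : realType}.
Variables (mu nu : {measure set T -> \bar R}) (f : T -> R).
Hypotheses (mf : measurable_fun setT f) (f0 : forall x, (0 <= f x)%R).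
Hypothesis nuE : forall A, measurable A -> nu A = \int[mu]_(x in A) (f x)%:E.

Import HBNNSimple.

Let integral_density_indic A : measurable A ->
  \int[nu]_x (\1_A x)%:E = \int[mu]_x ((\1_A x)%:E * (f x)%:E).
Proof.
move=> mA; rewrite integral_indic// setIT nuE// [LHS]integral_mkcond.
apply: eq_integral => x _; rewrite patchE indicE.
by case: ifP; rewrite ?mul1e ?mul0e.
Qed.

Let integral_density_nnsfun (g : {nnsfun T >-> R}) :
  \int[nu]_x (g x)%:E = \int[mu]_x ((g x)%:E * (f x)%:E).
Proof.
have mI r : measurable_fun setT (fun x => (r * \1_(g @^-1` [set r]) x)%:E).
  by apply/measurable_EFinP; exact: measurable_funM.
transitivity (\int[nu]_x (\sum_(r \in range g) (r * \1_(g @^-1` [set r]) x)%:E)).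
  by apply: eq_integral => x _; rewrite fimfunE -fsumEFin.
rewrite ge0_integral_fsum//; last by move=> r x _; exact: nnfun_muleindic_ge0.
transitivity (\int[mu]_x (\sum_(r \in range g)
    (r * \1_(g @^-1` [set r]) x)%:E * (f x)%:E)); last first.
  apply: eq_integral => x _.
  rewrite -ge0_mule_fsuml => [|r]; last exact: nnfun_muleindic_ge0.
  by rewrite fsumEFin// -fimfunE.
rewrite ge0_integral_fsum//; last 2 first.
- by move=> r; apply: emeasurable_funM => //; exact/measurable_EFinP.
- move=> r x _; apply: mule_ge0; last by rewrite lee_fin.
  exact: nnfun_muleindic_ge0.
apply: eq_fsbigr => r; rewrite inE => -[t _ gt].
have r0 : (0 <= r)%R by rewrite -gt.
under eq_integral do rewrite EFinM.
rewrite ge0_integralZl//; last by apply/measurable_EFinP; exact: measurable_indic.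
rewrite integral_density_indic//.
under [RHS]eq_integral do rewrite EFinM -muleA.
rewrite ge0_integralZl//.
- apply: emeasurable_funM; apply/measurable_EFinP => //.
- by move=> x _; rewrite mule_ge0// lee_fin.
Qed.

(** True for indicators by [nuE], then for simple functions by linearity, then in general by
    monotone convergence on both sides. *)
Lemma ge0_integral_density (h : T -> \bar R) :
  measurable_fun setT h -> (forall x, 0 <= h x) ->
  \int[nu]_x h x = \int[mu]_x (h x * (f x)%:E).
Proof.
move=> mh h0; pose g := nnsfun_approx measurableT mh.
have gh x : (g n x)%:E @[n --> \oo] --> h x.
  by apply: cvg_nnsfun_approx => //.
transitivity (\int[nu]_x limn (fun n => (g n x)%:E)).
  by apply: eq_integral => x _; apply/esym/cvg_lim.
rewrite monotone_convergence//; last 3 first.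
- by move=> n; exact/measurable_EFinP.
- by move=> n x _; rewrite lee_fin.
- by move=> x _ a b ab; rewrite lee_fin; exact/lefP/nd_nnsfun_approx.
under eq_fun do rewrite integral_density_nnsfun.
rewrite -monotone_convergence//; last 3 first.
- by move=> n; apply: emeasurable_funM; exact/measurable_EFinP.
- by move=> n x _; rewrite mule_ge0// lee_fin.
- move=> x _ a b ab; rewrite lee_wpmul2r// lee_fin//.
  exact/lefP/nd_nnsfun_approx.
apply: eq_integral => x _; apply/cvg_lim => //.
exact: cvgeZr.
Qed.

End integral_density.

Section affine.
Context {R : realType}.

Lemma measurable_affine (c s : R) : measurable_fun setT (fun x : R => c + s * x)%R.
Proof. by apply: measurable_funD => //; exact: measurable_funM. Qed.

(** Lebesgue measure is determined by its values on the intervals []a, b]], and the rescaled image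
    measure gives each of them its length. *)
Lemma lebesgue_measure_affine (c s : R) (A : set R) : (0 < s)%R -> measurable A ->
  lebesgue_measure A = s%:E * lebesgue_measure [set x : R | A (c + s * x)%R].
Proof.
move=> s0 mA.
pose f : measurableTypeR R -> measurableTypeR R := fun x => (c + s * x)%R.
have mf : measurable_fun setT f := measurable_affine c s.
pose m := mscale (NngNum (ltW s0)) (pushforward (@lebesgue_measure R) f)
  : {measure set (measurableTypeR R) -> \bar R}.
rewrite (@lebesgue_measure_unique _ (m mf))// => _ [[a b]] _ <-.
transitivity
  (s%:E * lebesgue_measure `]((a - c) / s)%R, ((b - c) / s)%R]%classic);
  last first.
  congr (_ * lebesgue_measure _); apply/seteqP; split => x /=.
    by rewrite /f !in_itv/= ltr_pdivrMr// ler_pdivlMr// ltrBlDl lerBrDl (mulrC x).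
  by rewrite /f !in_itv/= ltr_pdivrMr// ler_pdivlMr// ltrBlDl lerBrDl (mulrC x).
rewrite !lebesgue_measure_itv/= !lte_fin ltr_pM2r ?invr_gt0// ltrD2r.
case: ifPn => _; rewrite ?mule0// -!EFinB -EFinM; congr _%:E.
by rewrite -mulrBl mulrCA divff ?gt_eqF//; ring.
Qed.

Lemma ge0_integral_lebesgue_R_affine (c s : R) (h : R -> \bar R) : (0 < s)%R ->
  measurable_fun setT h -> (forall x, 0 <= h x) ->
  \int[lebesgue_R]_x h x = s%:E * \int[lebesgue_R]_x h (c + s * x)%R.
Proof.
move=> s0 mh h0; have mf := measurable_affine c s.
pose m := mscale (NngNum (ltW s0))
    (pushforward (@lebesgue_R R) (fun x => c + s * x)%R)
  : {measure set R -> \bar R}.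
transitivity (\int[m mf]_x h x).
  by apply: eq_measure_integral => A mA _; exact: lebesgue_measure_affine.
rewrite /m ge0_integral_mscale//; congr (_ * _).
by rewrite ge0_integral_pushforward.
Qed.

(** The density of [N(c, s^2)] relative to [N(0, 1)]. *)
Definition gauss_ratio (c s x : R) : R :=
  (s^-1 * expR ((x ^+ 2 - ((x - c) / s) ^+ 2) / 2))%R.

Lemma gauss_ratio_gt0 c s x : (0 < s)%R -> (0 < gauss_ratio c s x)%R.
Proof. by move=> s0; rewrite mulr_gt0 ?invr_gt0 ?expR_gt0. Qed.

Lemma measurable_gauss_ratio c s : measurable_fun setT (gauss_ratio c s).
Proof.
apply: measurable_funM => //; apply: measurableT_comp => //.
apply: measurable_funM => //; apply: measurable_funB; first exact: measurable_funX.
by apply: measurable_funX; apply: measurable_funM => //; exact: measurable_funB.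
Qed.

Lemma ge0_integral_std_normal_R (h : R -> \bar R) :
  measurable_fun setT h -> (forall x, 0 <= h x) ->
  \int[std_normal_R]_x h x = \int[lebesgue_R]_x (h x * (normal_pdf 0 1 x)%:E).
Proof.
move=> mh h0; apply: ge0_integral_density => //.
- exact: measurable_normal_pdf.
- by move=> x; exact: normal_pdf_ge0.
- by move=> A mA; exact: std_normal_RE.
Qed.

Lemma std_normal_R_affine (c s : R) (h : R -> \bar R) : (0 < s)%R ->
  measurable_fun setT h -> (forall x, 0 <= h x) ->
  \int[std_normal_R]_x h (c + s * x)%R =
  \int[std_normal_R]_x (h x * (gauss_ratio c s x)%:E).
Proof.
move=> s0 mh h0; rewrite !ge0_integral_std_normal_R//; last 3 first.
- apply: emeasurable_funM => //; apply/measurable_EFinP.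
  exact: measurable_gauss_ratio.
- by move=> x; rewrite mule_ge0// lee_fin ltW// gauss_ratio_gt0.
- exact: (measurableT_comp mh (measurable_affine c s)).
(* The Gaussian density is taken at the preimage [(y - c) / s], so that the left-hand side becomes
   the Lebesgue integral of [g] along the affine map. *)
pose g y := h y * (normal_pdf 0 1 ((y - c) / s)%R)%:E.
have g0 y : 0 <= g y by rewrite mule_ge0// lee_fin normal_pdf_ge0.
have mg : measurable_fun setT g.
  apply: emeasurable_funM => //; apply/measurable_EFinP.
  apply: (measurableT_comp (measurable_normal_pdf 0 1)).
  by apply: measurable_funM => //; exact: measurable_funB.
transitivity (\int[lebesgue_R]_x g (c + s * x)%R).
  apply: eq_integral => x _; rewrite /g; congr (_ * (normal_pdf _ _ _)%:E).
  by rewrite addrAC subrr add0r mulrAC divff ?gt_eqF// mul1r.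
transitivity (s^-1%:E * \int[lebesgue_R]_x g x).
  rewrite [in RHS](@ge0_integral_lebesgue_R_affine c s g s0 mg g0).
  rewrite muleA -EFinM mulVf ?gt_eqF//.
  by rewrite mul1e.
rewrite -ge0_integralZl ?lee_fin ?invr_ge0 ?ltW//.
apply: eq_integral => x _; rewrite /g muleCA -[RHS]muleA; congr (_ * _).
rewrite -!EFinM; congr _%:E.
rewrite !normal_pdfE ?oner_neq0// /gauss_ratio /normal_fun !subr0 expr1n.
rewrite -[RHS]mulrA; congr (_ * _)%R; rewrite mulrCA; congr (_ * _)%R.
by rewrite -expRD; congr (expR _); field; rewrite gt_eqF.
Qed.

End affine.

End gaussian_density.

(** * Coordinatewise affine images of the standard normal law *)

Section affine_images.
Local Open Scope ereal_scope.

Section affine_cV.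
Context {R : realType}.

Definition cV_affine n (c s z : 'cV[R]_n) : 'cV[R]_n :=
  (\col_i (c i 0 + s i 0 * z i 0))%R.

Definition cV_gauss_ratio n (c s z : 'cV[R]_n) : R :=
  (\prod_i gauss_ratio (c i 0) (s i 0) (z i 0))%R.

Lemma cV_gauss_ratio_gt0 n (c s z : 'cV[R]_n) : (forall i, 0 < s i 0%R)%R ->
  (0 < cV_gauss_ratio c s z)%R.
Proof. by move=> s0; apply: prodr_gt0 => i _; exact: gauss_ratio_gt0. Qed.

Lemma measurable_cV_gauss_ratio n (c s : 'cV[R]_n) :
  measurable_fun setT (cV_gauss_ratio c s).
Proof.
apply: measurable_prod => i _.
exact: (measurableT_comp (measurable_gauss_ratio _ _) (measurable_coord i 0%R)).
Qed.

Lemma measurable_cV_affine n (c s : 'cV[R]_n) :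
  measurable_fun setT (cV_affine c s).
Proof.
apply: measurable_matrix => i j; under eq_fun do rewrite mxE.
exact: (measurableT_comp (measurable_affine _ _) (measurable_coord i 0%R)).
Qed.

Lemma std_normal_cV_affine n (c s : 'cV[R]_n) (h : 'cV[R]_n -> \bar R) :
  (forall i, 0 < s i 0%R)%R -> measurable_fun setT h -> (forall v, 0 <= h v) ->
  \int[std_normal_cV]_z h (cV_affine c s z) =
  \int[std_normal_cV]_z (h z * (cV_gauss_ratio c s z)%:E).
Proof.
elim: n c s h => [|n IH] c s h s0 mh h0.
  have mha : measurable_fun setT (fun z => h (cV_affine c s z)).
    exact: (measurableT_comp mh (measurable_cV_affine c s)).
  have mhr : measurable_fun setT (fun z => h z * (cV_gauss_ratio c s z)%:E).
    by apply: emeasurable_funM => //; apply/measurable_EFinP;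
      exact: measurable_cV_gauss_ratio.
  rewrite !ge0_integral_std_normal_cV0// /cV_gauss_ratio big_ord0 mule1.
  by congr h; apply/matrixP => -[].
pose c' := (\col_i c (lift 0 i) 0)%R : 'cV[R]_n.
pose s' := (\col_i s (lift 0 i) 0)%R : 'cV[R]_n.
have s'0 i : (0 < s' i 0)%R by rewrite mxE.
have ratioS x v : (cV_gauss_ratio c s (cV_cons (x, v)) =
    gauss_ratio (c 0 0) (s 0 0) x * cV_gauss_ratio c' s' v)%R.
  rewrite /cV_gauss_ratio big_ord_recl cV_cons0; congr (_ * _)%R.
  by apply: eq_bigr => i _; rewrite cV_consS !mxE.
have affineS x v : cV_affine c s (cV_cons (x, v)) =
    cV_cons (c 0 0 + s 0 0 * x, cV_affine c' s' v)%R.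
  apply/matrixP => i j; rewrite ord1 mxE !cV_consE.
  by case: unliftP => [k ->|->]; rewrite ?mxE.
have mcons : measurable_fun setT (fun xv => h (cV_cons xv)).
  exact: (measurableT_comp mh measurable_cV_cons).
pose f xv := h (cV_cons xv) * (cV_gauss_ratio c' s' xv.2)%:E.
have f0 xv : 0 <= f xv.
  by rewrite mule_ge0// lee_fin ltW// cV_gauss_ratio_gt0.
have mf : measurable_fun setT f.
  apply: emeasurable_funM => //; apply/measurable_EFinP.
  exact: (measurableT_comp (measurable_cV_gauss_ratio _ _) measurable_snd).
(* [G] integrates out the tail, where the induction hypothesis has already replaced the affine map
   by its ratio; the one-dimensional formula then treats the head. *)
pose G x := \int[std_normal_cV]_v f (x, v).
have G0 x : 0 <= G x by apply: integral_ge0.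
have mG : measurable_fun setT G.
  exact: (measurable_fun_fubini_tonelli_F (m2 := @std_normal_cV R n) f).
rewrite ge0_integral_std_normal_cVS//; last first.
  exact: (measurableT_comp mh (measurable_cV_affine c s)).
transitivity (\int[std_normal_R]_x G (c 0 0 + s 0 0 * x)%R).
  apply: eq_integral => x _; rewrite /G /f /=.
  under eq_integral do rewrite affineS.
  apply: (IH c' s' (fun v => h (cV_cons (_, v)))) => //.
  exact: (measurableT_comp mcons (pair1_measurable _)).
rewrite (std_normal_R_affine _ (s0 0%R) mG G0) ge0_integral_std_normal_cVS//.
- apply: eq_integral => x _; rewrite muleC /G -ge0_integralZl//.
  + apply: eq_integral => v _; rewrite /f /= ratioS EFinM.
    by rewrite muleCA.
  + exact: (measurableT_comp mf (pair1_measurable _)).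
  + by rewrite lee_fin ltW// gauss_ratio_gt0.
- apply: emeasurable_funM => //; apply/measurable_EFinP.
  exact: measurable_cV_gauss_ratio.
- by move=> v; rewrite mule_ge0// lee_fin ltW// cV_gauss_ratio_gt0.
Qed.

End affine_cV.

Section dot.
Context {R : realType} {n : nat}.
Implicit Types u v w : 'cV[R]_n.

Definition dot u v : R := ((u^T *m v) 0 0)%R.

Lemma dotE u v : dot u v = (\sum_i u i 0 * v i 0)%R.
Proof. by rewrite /dot mxE; apply: eq_bigr => i _; rewrite mxE. Qed.

Lemma dotC u v : dot u v = dot v u.
Proof. by rewrite !dotE; apply: eq_bigr => i _; rewrite mulrC. Qed.

Lemma dotDl u v w : dot (u + v)%R w = (dot u w + dot v w)%R.
Proof. by rewrite /dot linearD mulmxDl mxE. Qed.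

Lemma dotDr u v w : dot w (u + v)%R = (dot w u + dot w v)%R.
Proof. by rewrite /dot mulmxDr mxE. Qed.

Lemma dotNl u v : dot (- u)%R v = (- dot u v)%R.
Proof. by rewrite /dot linearN mulNmx mxE. Qed.

Lemma dotNr u v : dot u (- v)%R = (- dot u v)%R.
Proof. by rewrite /dot mulmxN mxE. Qed.

Lemma dot_mulmx (M : 'M[R]_n) u v : dot u (M *m v) = dot (M^T *m u) v.
Proof. by rewrite /dot trmx_mul trmxK mulmxA. Qed.

Lemma measurable_dot d (T : measurableType d) (f g : T -> 'cV[R]_n) :
  measurable_fun setT f -> measurable_fun setT g ->
  measurable_fun setT (fun x => dot (f x) (g x)).
Proof.
move=> mf mg; apply: (measurableT_comp (measurable_coord 0%R 0%R)).
by apply: measurable_mulmx => //; exact: measurable_trmx.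
Qed.

(** With unit scales the ratio is the Cameron-Martin density of the translation by [u]. *)
Lemma cV_gauss_ratio1 u v :
  cV_gauss_ratio u (const_mx 1%R) v = expR (dot u v - dot u u / 2).
Proof.
rewrite /cV_gauss_ratio !dotE mulr_suml -sumrB expR_sum.
apply: eq_bigr => i _; rewrite /gauss_ratio mxE invr1 mul1r; congr expR.
by field.
Qed.

Lemma cV_affine1 u v : cV_affine u (const_mx 1%R) v = (v + u)%R.
Proof. by apply/matrixP => i j; rewrite ord1 !mxE mul1r addrC. Qed.

End dot.

End affine_images.

(** * Cameron-Martin formula and rotation invariance *)

Section rotations.
Local Open Scope ereal_scope.

Section rotation_invariance.
Context {R : realType} {n : nat}.
Local Notation gauss := (@std_normal_cV R n).

Definition cameron_martin (nu : {measure set 'cV[R]_n -> \bar R}) : Prop :=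
  forall (a : 'cV[R]_n) (h : 'cV[R]_n -> \bar R),
    measurable_fun setT h -> (forall v, 0 <= h v) ->
    \int[nu]_z (h z * (expR (dot a z - dot a a / 2))%:E) =
    \int[nu]_z h (z + a)%R.

Lemma cameron_martin_std_normal_cV : cameron_martin gauss.
Proof.
move=> a h mh h0.
transitivity (\int[gauss]_z h (cV_affine a (const_mx 1%R) z)); last first.
  by apply: eq_integral => z _; rewrite cV_affine1.
rewrite std_normal_cV_affine//; last by move=> i; rewrite mxE.
by apply: eq_integral => z _; rewrite cV_gauss_ratio1.
Qed.

(* The integral of 1_A(x + y) exp(- <x, y> - |x|^2 / 2) against nu(dy) gamma(dx)
   equals nu A by the formula for nu, and gamma A by the formula for gamma, then
   for nu, after exchanging the two integrals. *)
Lemma cameron_martin_unique (nu : probability 'cV[R]_n R) :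
  cameron_martin nu -> forall A, measurable A -> nu A = gauss A.
Proof.
(* [g] is the indicator of [A], kept abstract: only its sign, its measurability and its integrals
   matter below. *)
move=> cmnu A mA; have [g [g0 mg gE]] : exists g : 'cV[R]_n -> \bar R,
    [/\ forall z, 0 <= g z, measurable_fun setT g &
      forall m : {measure set 'cV[R]_n -> \bar R}, m A = \int[m]_z g z].
  exists (fun z => (\1_A z)%:E); split.
  - by move=> z; rewrite lee_fin.
  - by apply/measurable_EFinP; exact: measurable_indic.
  - by move=> m; rewrite integral_indic// setIT.
pose k (xy : 'cV[R]_n * 'cV[R]_n) : \bar R :=
  g (xy.1 + xy.2)%R * (expR (- dot xy.1 xy.2 - dot xy.1 xy.1 / 2))%:E.
have k0 xy : 0 <= k xy by rewrite mule_ge0// lee_fin expR_ge0.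
have mk : measurable_fun setT k.
  apply: emeasurable_funM.
    by apply: (measurableT_comp mg); exact: measurable_addmx.
  apply/measurable_EFinP; apply: measurableT_comp => //.
  apply: measurable_funB.
    by apply: measurableT_comp => //; exact: measurable_dot.
  by apply: measurable_funM => //; exact: measurable_dot.
pose l (xy : 'cV[R]_n * 'cV[R]_n) : \bar R :=
  g xy.1 * (expR (dot xy.1 xy.2 - dot xy.1 xy.1 / 2))%:E.
have l0 xy : 0 <= l xy by rewrite mule_ge0// lee_fin expR_ge0.
have ml : measurable_fun setT l.
  apply: emeasurable_funM; first exact: (measurableT_comp mg).
  apply/measurable_EFinP; apply: measurableT_comp => //.
  apply: measurable_funB; first exact: measurable_dot.
  by apply: measurable_funM => //; exact: measurable_dot.
transitivity (\int[gauss]_x \int[nu]_y k (x, y)).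
  transitivity (\int[gauss]_x (cst (nu A) x)).
    by rewrite integral_cst// [X in _ * X]probability_setT mule1.
  apply: eq_integral => x _; rewrite /= gE.
  transitivity (\int[nu]_y g (x + (y + - x))%R).
    by apply: eq_integral => y _; rewrite addrC subrK.
  have mgx : measurable_fun setT (fun y => g (x + y)%R).
    by apply: (measurableT_comp mg); exact: measurable_addmx.
  apply: etrans (esym (cmnu (- x)%R _ mgx _)) _; first by move=> y; exact: g0.
  by apply: eq_integral => y _; rewrite /k /= !dotNl dotNr opprK.
apply: etrans (fubini_tonelli k mk k0) _.
transitivity (\int[nu]_y \int[gauss]_x l (x, y)).
  apply: eq_integral => y _.
  (* [h] is what remains of [k] once the Cameron-Martin density of the shift by [- y] is split off.
     The shift turns its exponent into [|y|^2/2 - |x - y|^2/2], which equals [<x, y> - |x|^2/2], the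
     exponent of [l]. *)
  pose h x := g (x + y)%R * (expR (dot y y / 2 - dot x x / 2))%:E.
  transitivity (\int[gauss]_x
      (h x * (expR (dot (- y)%R x - dot (- y)%R (- y)%R / 2))%:E)).
    apply: eq_integral => x _; rewrite /k /h /= -muleA -EFinM -expRD.
    congr (_ * (expR _)%:E); rewrite !dotNl dotNr (dotC y x); ring.
  rewrite cameron_martin_std_normal_cV.
  - apply: eq_integral => x _; rewrite /h /l /= subrK.
    congr (_ * (expR _)%:E).
    by rewrite !(dotDl, dotDr, dotNl, dotNr) (dotC y x); field.
  - apply: emeasurable_funM.
      by apply: (measurableT_comp mg); exact: measurable_addmx.
    apply/measurable_EFinP; apply: measurableT_comp => //.
    apply: measurable_funB => //.
    by apply: measurable_funM => //; exact: measurable_dot.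
  - by move=> x; rewrite mule_ge0// lee_fin expR_ge0.
rewrite gE; apply: etrans (esym (fubini_tonelli l ml l0)) _; apply: eq_integral => x _.
rewrite /l /= ge0_integralZl//.
(* The inner integral is 1, by the formula for [nu] applied to the constant function 1. *)
- transitivity (g x * \int[nu]_y cst 1 (y + x)%R); last first.
    by rewrite integral_cst// [X in _ * (_ * X)]probability_setT !mule1.
  congr (_ * _); apply: etrans _ (cmnu x (cst 1) _ _) => //.
  by apply: eq_integral => y _; rewrite mul1e.
- apply/measurable_EFinP; apply: measurableT_comp => //.
  by apply: measurable_funB => //; exact: measurable_dot.
Qed.

Lemma measurable_mulmxl (M : 'M[R]_n) :
  measurable_fun setT (fun z : 'cV[R]_n => M *m z).
Proof. exact: measurable_mulmx. Qed.

(** The image of the standard normal law under [O] again satisfies the Cameron-Martin formula, since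
    [<a, O z> = <O^T a, z>] and [O^T] preserves norms; uniqueness concludes. *)
Lemma std_normal_cV_rotation (O : 'M[R]_n) (A : set 'cV[R]_n) :
  orthogonalmx O -> measurable A -> gauss [set z | A (O *m z)] = gauss A.
Proof.
move=> OO mA.
have OOT : O *m O^T = 1%:M by apply: mulmx1C.
pose mf := isMeasurableFun.Build _ _ _ _ _ (measurable_mulmxl O).
pose f : {mfun _ >-> _} := HB.pack (fun z : 'cV[R]_n => O *m z) mf.
apply: (@cameron_martin_unique (distribution gauss f)) => // a h mh h0.
rewrite !ge0_integral_distribution//=; last 3 first.
- apply: (measurableT_comp mh); exact: measurable_addmx.
- apply: emeasurable_funM => //; apply/measurable_EFinP.
  apply: measurableT_comp => //.
  by apply: measurable_funB => //; exact: measurable_dot.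
- by move=> z; rewrite mule_ge0// lee_fin expR_ge0.
have aE : a = O *m (O^T *m a) by rewrite mulmxA OOT mul1mx.
transitivity (\int[gauss]_z (h (O *m z) *
    (expR (dot (O^T *m a) z - dot (O^T *m a) (O^T *m a) / 2))%:E)).
  have dE : dot (O^T *m a) (O^T *m a) = dot a a.
    by rewrite (dot_mulmx O^T) trmxK -aE.
  by apply: eq_integral => z _; rewrite (dot_mulmx O a z) dE.
have mhO : measurable_fun setT (fun z => h (O *m z)).
  exact: (measurableT_comp mh (measurable_mulmxl O)).
apply: etrans (cameron_martin_std_normal_cV (O^T *m a) mhO _) _ => //.
by apply: eq_integral => z _; rewrite mulmxDr -aE.
Qed.

End rotation_invariance.

End rotations.

(** * The likelihood ratio in the coordinate [z] *)

Section densities.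
Local Open Scope ereal_scope.

Section likelihood_ratio.
Context {d d'} {Z : measurableType d} {X : measurableType d'} {R : realType}.
Variables (gamma : {measure set Z -> \bar R}) (leb : {measure set X -> \bar R}).
Variables (f : Z -> X) (g : X -> Z).
Hypotheses (mf : measurable_fun setT f) (mg : measurable_fun setT g).
Hypotheses (fK : cancel f g).
Variables (L0 L1 : X -> R) (r : Z -> R).
Hypotheses (mL0 : measurable_fun setT L0) (mL1 : measurable_fun setT L1).
Hypotheses (L0_ge0 : forall x, (0 <= L0 x)%R) (L1_ge0 : forall x, (0 <= L1 x)%R).
Hypotheses (mr : measurable_fun setT r) (r_gt0 : forall z, (0 < r z)%R).
Hypothesis L0E : forall A, measurable A ->
  gamma (f @^-1` A) = \int[leb]_(x in A) (L0 x)%:E.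
Hypothesis L1E : forall A, measurable A ->
  \int[gamma]_z ((\1_A (f z))%:E * (r z)%:E) = \int[leb]_(x in A) (L1 x)%:E.
Hypothesis L1_finite : \int[leb]_x (L1 x)%:E < +oo.

(** Both functions have the same integral over every measurable set: [L0] is the density of the
    image of [gamma] under [f], and [r (g (f z)) = r z]. Finiteness of the integral of [L1] allows
    the uniqueness of densities to be applied. *)
Let ratio_ae_eq :
  ae_eq leb setT (fun x => (L1 x)%:E) (fun x => (r (g x) * L0 x)%:E).
Proof.
have mrg : measurable_fun setT (fun x => r (g x)) := measurableT_comp mr mg.
apply: integral_ae_eq => //.
- apply/integrableP; split; first exact/measurable_EFinP.
  by under eq_integral do rewrite gee0_abs ?lee_fin//.
- by apply/measurable_EFinP; exact: measurable_funM.
move=> A _ mA; rewrite -L1E//.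
pose h x := (\1_A x * r (g x))%:E.
have h0 x : 0 <= h x by rewrite lee_fin mulr_ge0// ltW.
have mh : measurable_fun setT h.
  by apply/measurable_EFinP; exact: measurable_funM.
transitivity (\int[gamma]_z h (f z)).
  by apply: eq_integral => z _; rewrite /h fK EFinM.
transitivity (\int[pushforward gamma f]_x h x).
  by rewrite ge0_integral_pushforward.
rewrite (ge0_integral_density (mu := leb) (f := L0))//.
rewrite [RHS]integral_mkcond; apply: eq_integral => x _.
rewrite patchE /h indicE; case: ifPn => _; last by rewrite mul0r mul0e.
by rewrite mul1r EFinM.
Qed.

(** The exceptional points are those with [f z] in the null set where [L1 = (r \o g) L0] fails, or
    with [L0 (f z) = 0]. Both sets are [gamma]-null because the law of [f] has density [L0].
    Elsewhere all factors are positive and the logarithm splits. *)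
Lemma log_likelihood_ratio_ae :
  {ae gamma, forall z, ln (L1 (f z)) - ln (L0 (f z)) = ln (r z)}%R.
Proof.
have [N [mN N0 subN]] := ratio_ae_eq.
have mf' A : measurable A -> measurable (f @^-1` A).
  by move=> mA; rewrite -[X in measurable X]setTI; exact: mf.
have mZ : measurable (L0 @^-1` [set 0%R]).
  by rewrite -[X in measurable X]setTI; exact: mL0.
have zN : gamma (f @^-1` N) = 0.
  rewrite L0E//; apply: null_set_integral => //.
  by apply/measurable_EFinP; exact: measurable_funTS.
have zL : gamma (f @^-1` (L0 @^-1` [set 0%R])) = 0.
  by rewrite L0E//; apply: integral0_eq => x ->.
apply: (@negligibleS _ _ _ _ (f @^-1` N `|` f @^-1` (L0 @^-1` [set 0%R]))).
- move=> z /= Hz; apply: contrapT => /not_orP[NzN /eqP L0z].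
  apply: Hz; have L0_gt0 : (0 < L0 (f z))%R by rewrite lt0r L0z L0_ge0.
  have -> : L1 (f z) = (r (g (f z)) * L0 (f z))%R.
    by apply: contrapT => H; apply/NzN/subN => /= /(_ I) [E]; exact: H.
  by rewrite fK lnM ?posrE// addrK.
- by apply: negligibleU; apply/negligibleP => //; exact: mf'.
Qed.

End likelihood_ratio.

Lemma eq_measure_ae {d} {T : measurableType d} {R : realType}
    (mu : {measure set T -> \bar R}) (A B : set T) :
  measurable A -> measurable B -> {ae mu, forall t, A t <-> B t} -> mu A = mu B.
Proof.
move=> mA mB AB; rewrite -[A]setIT -[B]setIT -!integral_indic//.
apply: ae_eq_integral => //; try by apply/measurable_EFinP; exact: measurable_indic.
apply: filterS AB => t ABt _; rewrite !indicE.
suff -> : (t \in A) = (t \in B) by [].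
by apply/idP/idP; rewrite !inE => /ABt.
Qed.

End densities.

(** * Simultaneous diagonalization of the two normal laws *)

Lemma orthogonalmx_tr {R : realType} {n : nat} (O : 'M[R]_n) :
  O *m O^T = 1%:M -> orthogonalmx O.
Proof. exact: mulmx1C. Qed.

Section whitening.
Context {R : realType} {N : nat}.
Variables (M0 M1 : 'cV[R]_N) (S0 S1 G0 G1 Q Psi : 'M[R]_N) (lam : 'rV[R]_N).
Hypotheses (S0_unit : S0 \in unitmx) (S1_unit : S1 \in unitmx).
Hypotheses (G0E : G0 *m G0^T = S0) (G1E : G1 *m G1^T = S1).
Hypotheses (sqrtQ : psd_sqrt_of S0 Q).
Hypothesis eigPsi : eigendecomposition (Q *m invmx S1 *m Q) Psi lam.

Let QT : Q^T = Q. Proof. by case: sqrtQ => -[]. Qed.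
Let QQ : Q *m Q = S0. Proof. by case: sqrtQ. Qed.
Let Q_unit : Q \in unitmx.
Proof. by move: S0_unit; rewrite -QQ unitmx_mul => /andP[]. Qed.
Let PsiTPsi : Psi^T *m Psi = 1%:M. Proof. by case: eigPsi. Qed.
Let PsiPsiT : Psi *m Psi^T = 1%:M. Proof. exact: mulmx1C. Qed.
Let G1_unit : G1 \in unitmx.
Proof. by move: S1_unit; rewrite -G1E unitmx_mul => /andP[]. Qed.

(** [W W^T = S0], while [W^T S1^-1 W] is diagonal with entries [lam]; [Wi] is the inverse of [W]. *)
Let W := Q *m Psi.
Let Wi := Psi^T *m invmx Q.
Let D := M1 - M0.
Let c := Wi *m D.

Let WiW : Wi *m W = 1%:M.
Proof. by rewrite /Wi /W mulmxA -(mulmxA Psi^T) mulVmx// mulmx1. Qed.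
Let WWi : W *m Wi = 1%:M. Proof. exact: mulmx1C. Qed.

Let WS1W : W^T *m invmx S1 *m W = diag_mx lam.
Proof.
rewrite /W trmx_mul QT -!mulmxA (mulmxA (invmx S1)) (mulmxA Q) (mulmxA Q (invmx S1)).
by rewrite eigPsi.2 !mulmxA PsiTPsi mul1mx -mulmxA PsiTPsi mulmx1.
Qed.

Let WTinvS1 : W^T *m invmx S1 = diag_mx lam *m Wi.
Proof. by rewrite -WS1W -mulmxA WWi mulmx1. Qed.

Let invS1 : invmx S1 = (invmx G1)^T *m invmx G1.
Proof.
rewrite -[RHS](mulKmx S1_unit) -[LHS]mulmx1; congr (_ *m _).
by rewrite -[in RHS]G1E !mulmxA -(mulmxA G1) -trmx_mul mulVmx// trmx1 mulmx1
  mulmxV// mulmx1.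
Qed.

(** The diagonal matrix is [H^T H] with [H = G1^-1 W] invertible, so its entries are sums of squares
    and its determinant is not zero. *)
Let lam_gt0 j : 0 < lam 0 j.
Proof.
pose H := invmx G1 *m W.
have HH : H^T *m H = diag_mx lam.
  by rewrite -WS1W invS1 trmx_mul !mulmxA.
have lamE : lam 0 j = \sum_i H i j ^+ 2.
  transitivity ((H^T *m H) j j); first by rewrite HH mxE eqxx mulr1n.
  by rewrite mxE; apply: eq_bigr => i _; rewrite mxE expr2.
rewrite lt0r lamE sumr_ge0 ?andbT; last by move=> i _; exact: sqr_ge0.
rewrite -lamE; apply: contraTneq isT => lamj0.
have : diag_mx lam \in unitmx.
  rewrite -HH unitmx_mul unitmx_tr andbb unitmx_mul unitmx_inv G1_unit/=.
  by case/mulmx1_unit : WWi.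
by rewrite unitmxE det_diag (bigD1 j)//= lamj0 mul0r unitr0.
Qed.

Let sq : 'rV[R]_N := \row_j Num.sqrt (lam 0 j).
Let s : 'cV[R]_N := \col_j (Num.sqrt (lam 0 j))^-1.

Let s_gt0 j : 0 < s j 0.
Proof. by rewrite mxE invr_gt0 sqrtr_gt0 lam_gt0. Qed.

Let sqsq : diag_mx sq *m diag_mx sq = diag_mx lam.
Proof.
rewrite mulmx_diag; congr diag_mx; apply/rowP => j.
by rewrite !mxE -expr2 sqr_sqrtr// ltW.
Qed.

(** [G0 = W O0] and [G1 = W Lambda^{-1/2} O1]: two square factors of the same invertible covariance
    differ by an orthogonal matrix. *)
Let O0 := Wi *m G0.
Let O1 := diag_mx sq *m Wi *m G1.

Let O0_orthogonal : orthogonalmx O0.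
Proof.
apply: orthogonalmx_tr; rewrite trmx_mul !mulmxA -(mulmxA Wi) G0E -QQ.
rewrite /Wi trmx_mul trmxK trmx_inv QT !mulmxA.
by rewrite -(mulmxA Psi^T) mulVmx// mulmx1 -(mulmxA Psi^T) mulmxV// mulmx1.
Qed.

Let O1_orthogonal : orthogonalmx O1.
Proof.
rewrite /orthogonalmx.
have -> : O1^T = G1^T *m Wi^T *m diag_mx sq.
  by rewrite /O1 (trmx_mul _ G1) (trmx_mul _ Wi) tr_diag_mx mulmxA.
rewrite /O1 -(mulmxA (diag_mx sq)) (mulmxA _ (diag_mx sq)).
rewrite -(mulmxA _ (diag_mx sq) (diag_mx sq)) sqsq.
rewrite -(mulmxA (G1^T *m Wi^T)) (mulmxA (diag_mx lam)) -WTinvS1.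
rewrite -(mulmxA W^T) mulmxA -(mulmxA G1^T) -(trmx_mul W Wi) WWi trmx1 mulmx1.
by rewrite invS1 !mulmxA -trmx_mul mulVmx// trmx1 mul1mx mulVmx.
Qed.

Let Y0E z : M0 + G0 *m z = M0 + W *m (O0 *m z).
Proof. by rewrite /O0 -mulmxA (mulmxA W) WWi mul1mx. Qed.

Let Y1E z : M1 + G1 *m z = M0 + W *m cV_affine c s (O1 *m z).
Proof.
have -> : cV_affine c s (O1 *m z) = c + Wi *m (G1 *m z).
  rewrite /O1 -(mulmxA _ G1) -(mulmxA (diag_mx sq)) mul_diag_mx.
  move: (Wi *m (G1 *m z)) c => v c'.
  apply/colP => j; rewrite !mxE; congr (_ + _).
  rewrite mulrA mulVf ?mul1r//.
  by rewrite gt_eqF// sqrtr_gt0.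
rewrite mulmxDr (mulmxA W Wi) /c (mulmxA W Wi) WWi !mul1mx /D.
by rewrite addrA addrCA subrr addr0.
Qed.

Let b := Psi^T *m Q *m invmx S1 *m D.

Let bE j : b j 0 = lam 0 j * c j 0.
Proof.
have -> : b = diag_mx lam *m c.
  by rewrite /c mulmxA -WTinvS1 /W trmx_mul QT.
by rewrite mul_diag_mx mxE.
Qed.

Let DE : (D^T *m invmx S1 *m D) 0 0 = \sum_j lam 0 j * c j 0 ^+ 2.
Proof.
have DWc : D = W *m c by rewrite /c mulmxA WWi mul1mx.
rewrite [in LHS]DWc (trmx_mul W) -(mulmxA c^T W^T) -(mulmxA c^T) (mulmxA _ W).
rewrite WS1W mul_diag_mx.
rewrite mxE; apply: eq_bigr => j _; rewrite !mxE; ring.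
Qed.

Let detE : \det S0 / \det S1 = \prod_j lam 0 j.
Proof.
rewrite -det_diag -WS1W !det_mulmx det_inv det_tr /W det_mulmx -QQ det_mulmx.
(* The determinant of [Psi] is known only up to sign, but it enters squared. *)
have : \det Psi * \det Psi = 1 by rewrite -{1}(det_tr Psi) -det_mulmx PsiTPsi det1.
by move=> /(congr1 ( *%R (\det Q * \det Q / \det S1))); rewrite mulr1 => <-; ring.
Qed.

(** For variance [1 / l] and mean [x], the coefficient [(1 - l) / 2] of [y ^+ 2] yields the weight
    [w_j], and [l * x] yields the entry [b_{0,j}]. *)
Let ln_gauss_ratio_sqrt l (x y : R) : 0 < l ->
  ln (gauss_ratio x (Num.sqrt l)^-1 y) =
  ln l / 2 + ((1 - l) / 2 * y ^+ 2 + l * x * y - l * x ^+ 2 / 2).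
Proof.
move=> l0; have sl0 : 0 < Num.sqrt l by rewrite sqrtr_gt0.
rewrite /gauss_ratio invrK lnM ?posrE ?expR_gt0// expRK; congr (_ + _).
  by rewrite -[in RHS](@sqr_sqrtr _ l) ?ltW// lnXn// -(mulr_natr (ln _)) mulfK.
by rewrite exprMn sqr_sqrtr ?ltW//; field.
Qed.

Let ln_prod (F : 'I_N -> R) : (forall j, 0 < F j) ->
  ln (\prod_j F j) = \sum_j ln (F j).
Proof.
(* Positivity of the partial products is carried through the induction, as [lnM] requires it. *)
move=> F0; apply: (@proj2 (0 < \prod_j F j)).
apply: (big_ind2 (fun x y => 0 < x /\ ln x = y)).
- by rewrite ltr01 ln1.
- by move=> x1 _ x2 _ [x10 <-] [x20 <-]; rewrite mulr_gt0// lnM.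
- by move=> j _; split.
Qed.

Let ratioE z : ln (cV_gauss_ratio c s z) =
  \sum_j ((1 - lam 0 j) / 2 * z j 0 ^+ 2 + b j 0 * z j 0)
  + (ln (\det S0 / \det S1) - (D^T *m invmx S1 *m D) 0 0) / 2.
Proof.
rewrite /cV_gauss_ratio ln_prod; last by move=> j; exact: gauss_ratio_gt0.
rewrite detE ln_prod// DE mulrBl !mulr_suml -sumrB -big_split /=.
apply: eq_bigr => j _; rewrite bE.
have -> : s j 0 = (Num.sqrt (lam 0 j))^-1 by rewrite mxE.
by rewrite ln_gauss_ratio_sqrt//; ring.
Qed.

(** [G0] and [G1] are arbitrary factors of the covariances. They enter only through the orthogonal
    [U0] and [U1], which rotation invariance removes afterwards. *)
Lemma simultaneous_diagonalization :
  exists (W' Wi' U0 U1 : 'M[R]_N) (c' s' : 'cV[R]_N),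
  [/\ Wi' *m W' = 1%:M,
      orthogonalmx U0 /\ orthogonalmx U1,
      (forall j, 0 < s' j 0),
      (forall z, M0 + G0 *m z = M0 + W' *m (U0 *m z)) /\
      (forall z, M1 + G1 *m z = M0 + W' *m cV_affine c' s' (U1 *m z)) &
      forall z, ln (cV_gauss_ratio c' s' z) =
        \sum_j ((1 - lam 0 j) / 2 * z j 0 ^+ 2
                + (Psi^T *m Q *m invmx S1 *m (M1 - M0)) j 0 * z j 0)
        + (ln (\det S0 / \det S1)
           - ((M1 - M0)^T *m invmx S1 *m (M1 - M0)) 0 0) / 2].
Proof. by exists W, Wi, O0, O1, c, s. Qed.

End whitening.

(** * The log-likelihood ratio as a diagonal quadratic polynomial in normal variables *)

Section log_likelihood_ratio.
Local Open Scope ereal_scope.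

Lemma measurable_affine_cV {R : realType} {n} (M : 'cV[R]_n) (W : 'M[R]_n) :
  measurable_fun setT (fun z : 'cV[R]_n => M + W *m z)%R.
Proof. by apply: measurable_addmx => //; exact: measurable_mulmx. Qed.

Lemma log_likelihood_ratio_law {d} {Omega : measurableType d} {R : realType}
    {N : nat}
    (P0 P1 : probability Omega R) (Y : Omega -> 'cV[R]_N) (L0 L1 : 'cV[R]_N -> R)
    (M0 M1 : 'cV[R]_N) (S0 S1 Q Psi : 'M[R]_N) (lam : 'rV[R]_N) (A : set R) :
  S0 \in unitmx -> S1 \in unitmx ->
  mvnormal P0 Y M0 S0 -> mvnormal P1 Y M1 S1 ->
  density_of P0 Y L0 -> density_of P1 Y L1 ->
  psd_sqrt_of S0 Q -> eigendecomposition (Q *m invmx S1 *m Q) Psi lam ->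
  measurable A ->
  P0 [set t | A (ln (L1 (Y t)) - ln (L0 (Y t)))%R] =
  std_normal_cV [set z : 'cV[R]_N | A
    (\sum_j ((1 - lam 0 j) / 2 * z j 0 ^+ 2
             + (Psi^T *m Q *m invmx S1 *m (M1 - M0)) j 0 * z j 0)
     + (ln (\det S0 / \det S1)
        - ((M1 - M0)^T *m invmx S1 *m (M1 - M0)) 0 0) / 2)%R].
Proof.
move=> uS0 uS1 [G0 G0E Y0] [G1 G1E Y1] [mL0 L0_ge0 YL0] [mL1 L1_ge0 YL1] sQ eP mA.
case: (simultaneous_diagonalization M0 M1 uS0 uS1 G0E G1E sQ eP).
move=> W [Wi] [U0] [U1] [c] [s] [WiW [oU0 oU1] s0 [GE0 GE1] lnE].
pose f z := (M0 + W *m z)%R; pose g y := (Wi *m (y - M0))%R.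
have mf : measurable_fun setT f := measurable_affine_cV M0 W.
have mg : measurable_fun setT g.
  by apply: measurable_mulmx => //; exact: measurable_addmx.
have fK : cancel f g by move=> z; rewrite /g /f addrAC subrr add0r mulmxA WiW mul1mx.
have mpre (B : set 'cV[R]_N) : measurable B -> measurable (f @^-1` B).
  by move=> mB; rewrite -[X in measurable X]setTI; exact: mf.
(* Under [P0], [Y] has the law of [f] under the standard normal law, with [U0] absorbed by rotation
   invariance. *)
have law0 B : measurable B -> P0 (Y @^-1` B) = std_normal_cV (f @^-1` B).
  move=> mB; rewrite Y0// -[RHS](std_normal_cV_rotation oU0 (mpre B mB)).
  by congr std_normal_cV; apply/seteqP; split => z /=; rewrite GE0.
(* Under [P1], [Y] has the law of [f] under the measure with density [cV_gauss_ratio c s] relative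
   to the standard normal law. *)
have law1 B : measurable B -> P1 (Y @^-1` B) =
    \int[std_normal_cV]_z ((\1_B (f z))%:E * (cV_gauss_ratio c s z)%:E).
  move=> mB; have mB' := mpre B mB.
  have mB'' : measurable (cV_affine c s @^-1` (f @^-1` B)).
    by rewrite -[X in measurable X]setTI; exact: measurable_cV_affine.
  rewrite -(@std_normal_cV_affine R N c s (fun z => (\1_B (f z))%:E) s0)//.
  - rewrite Y1// [LHS](_ : _ = std_normal_cV (cV_affine c s @^-1` (f @^-1` B))).
      rewrite -[in LHS](setIT (_ @^-1` _)) -integral_indic//.
    rewrite -[RHS](std_normal_cV_rotation oU1 mB'').
    by congr std_normal_cV; apply/seteqP; split => z /=; rewrite GE1.
  - apply/measurable_EFinP; apply: measurableT_comp mf.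
    exact: measurable_indic.
have finL1 : \int[lebesgue_cV]_y (L1 y)%:E < +oo.
  by rewrite -(YL1 setT)// preimage_setT probability_setT ltry.
have /= ae := log_likelihood_ratio_ae (gamma := @std_normal_cV R N)
  (leb := @lebesgue_cV R N) mf mg fK mL0 mL1 L0_ge0 L1_ge0
  (measurable_cV_gauss_ratio c s) (fun z => cV_gauss_ratio_gt0 c z s0)
  (fun B mB => etrans (esym (law0 B mB)) (YL0 B mB))
  (fun B mB => etrans (esym (law1 B mB)) (YL1 B mB)) finL1.
have mLLR : measurable_fun setT (fun y => ln (L1 y) - ln (L0 y))%R.
  by apply: measurable_funB; exact: measurableT_comp.
have mB : measurable [set y | A (ln (L1 y) - ln (L0 y))%R].
  by rewrite -[X in measurable X]setTI; exact: mLLR.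
rewrite (law0 _ mB); apply: eq_measure_ae.
- exact: mpre.
- under eq_set do rewrite -lnE.
  rewrite -[X in measurable X]setTI.
  apply: (measurableT_comp (@measurable_ln R)
    (measurable_cV_gauss_ratio c s)) => //.
- by apply: filterS ae => z /= ->; rewrite lnE.
Qed.

End log_likelihood_ratio.

(** * Independence and marginals of the coordinates *)

Section coordinates.
Context {R : realType}.
Local Open Scope ereal_scope.

Lemma std_normal_cV_box n (B : 'I_n -> set R) : (forall i, measurable (B i)) ->
  std_normal_cV [set v : 'cV[R]_n | forall i, B i (v i 0%R)] =
  \prod_i std_normal_R (B i).
Proof.
elim: n B => [|n IH] B mB.
  rewrite big_ord0 /std_normal_cV /= diracE mem_set//.
  by move=> [].
rewrite big_ord_recl -(IH (fun i => B (lift 0%R i)))//.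
apply: etrans (product_powerS std_normal_R _) _.
pose p := std_normal_cV [set v : 'cV[R]_n | forall i, B (lift 0%R i) (v i 0%R)].
transitivity (\int[std_normal_R]_x (p * (\1_(B 0%R) x)%:E)).
  apply: eq_integral => x _; rewrite indicE.
  have [xB|xB] := boolP (x \in B 0%R).
    rewrite mule1; congr std_normal_cV; apply/seteqP; split => v /= H i.
      by rewrite -(cV_consS x).
    case: (unliftP 0%R i) => [j ->|->]; first by rewrite cV_consS.
    by rewrite cV_cons0; rewrite inE in xB.
  rewrite mule0 -[RHS](measure0 (@std_normal_cV R n)); congr std_normal_cV.
  apply/seteqP; split => v //= /(_ 0%R); rewrite cV_cons0 => xB'.
  by move/negP: xB; apply; rewrite inE.
rewrite ge0_integralZl//.
- by rewrite integral_indic// setIT muleC.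
- by apply/measurable_EFinP; exact: measurable_indic.
- exact: measure_ge0.
Qed.

Lemma std_normal_cV_coord n (i : 'I_n) (B : set R) : measurable B ->
  std_normal_cV [set v : 'cV[R]_n | B (v i 0%R)] = std_normal_R B.
Proof.
move=> mB; pose C j := if j == i then B else setT.
rewrite [X in std_normal_cV X](_ : _ = [set v : 'cV[R]_n | forall j, C j (v j 0%R)]).
  rewrite std_normal_cV_box; last by move=> j; rewrite /C; case: ifP.
  rewrite (bigD1 i)//= {1}/C eqxx big1 ?mule1// => j /negbTE ji.
  by rewrite /C ji; exact: (@probability_setT _ _ _ (@std_normal_R R)).
apply/seteqP; split => v /=; last by move=> /(_ i); rewrite /C eqxx.
by move=> Bv j; rewrite /C; case: eqP => [->|].
Qed.

(** As [f] is injective, each coordinate is constrained by at most one event, so a finite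
    intersection of events is a box, whose measure factors. *)
Lemma coordinates_independent n (I : choiceType) (f : I -> 'I_n)
    (F : I -> set (set 'cV[R]_n)) : injective f ->
  (forall k, F k `<=` sigma_rv (fun v : 'cV[R]_n => v (f k) 0%R)) ->
  mutually_independent std_normal_cV F.
Proof.
move=> finj FS s E us FE.
have /choice[B BE] : forall k, exists Bk : set R, measurable Bk /\
    (k \in s -> E k = [set v | Bk (v (f k) 0%R)]).
  move=> k.
  have [ks|] := boolP (k \in s); last by exists set0; split.
  by have [Bk mBk <-] := FS _ _ (FE _ ks); exists Bk; split; rewrite // setTI.
(* The side of the box at [i]: it is [B k] when [i = f k] for some [k] in [s], and the whole line
   otherwise. *)
pose C i := [set x : R | forall k, k \in s -> f k = i -> B k x].
have CB k : k \in s -> C (f k) = B k.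
  move=> ks; apply/seteqP; split => x /=; first by apply.
  by move=> Bx l _ /finj ->.
have CT i : i \notin map f s -> C i = setT.
  move=> /mapP nis; apply/seteqP; split => // x _ k ks fk.
  by exfalso; apply: nis; exists k.
have mC i : measurable (C i).
  have [/mapP[k ks ->]|/CT ->//] := boolP (i \in map f s).
  by rewrite CB//; have [] := BE k.
transitivity (std_normal_cV [set v : 'cV[R]_n | forall i, C i (v i 0%R)]).
  congr std_normal_cV; apply/seteqP; split => v /= Hv.
    move=> i k ks fk; have := Hv k ks; rewrite (BE k).2//=.
    by rewrite fk.
  by move=> k /= ks; rewrite (BE k).2//=; exact: Hv.
rewrite std_normal_cV_box// (bigID (mem (map f s)))/= [X in _ * X]big1 ?mule1.
  rewrite -big_uniq/=; last by rewrite map_inj_uniq.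
  rewrite big_map; apply: eq_big_seq => k ks.
  by rewrite CB// (BE k).2// std_normal_cV_coord//; have [] := BE k.
by move=> i /CT ->; exact: (@probability_setT _ _ _ (@std_normal_R R)).
Qed.

Lemma std_normal_cV_tail n (A : set 'cV[R]_n) :
  std_normal_cV [set v : 'cV[R]_n.+1 | A (\col_i v (lift 0%R i) 0%R)%R] =
  std_normal_cV A.
Proof.
apply: etrans (product_powerS std_normal_R _) _.
transitivity (\int[std_normal_R]_x (cst (std_normal_cV A) x)).
  apply: eq_integral => x _; congr std_normal_cV.
  have tailE v : (\col_i cV_cons (x, v) (lift 0 i) 0)%R = v.
    by apply/colP => i; rewrite mxE cV_consS.
  by apply/seteqP; split => v /=; rewrite tailE.
by rewrite integral_cst// [X in _ * X](@probability_setT _ _ _ (@std_normal_R R))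
  mule1.
Qed.

End coordinates.

(** * Householder reflections *)

Section householder.
Context {R : realType} {n : nat}.
Implicit Types (u v : 'cV[R]_n) (k : R).

Definition householder k u : 'M[R]_n := 1%:M - k *: (u *m u^T).

Lemma householderE k u v : householder k u *m v = v - (k * dot u v) *: u.
Proof.
rewrite /householder mulmxBl mul1mx -scalemxAl -mulmxA.
rewrite [u^T *m v]mx11_scalar mul_mx_scalar scalerA.
by rewrite /dot.
Qed.

(** The condition, free of division, covers both the reflection, [k = 2 / |u|^2], and the identity,
    [k = 0]. *)
Lemma householder_orthogonal k u : k * k * dot u u = 2 * k ->
  orthogonalmx (householder k u).
Proof.
move=> kE.
have sym : (householder k u)^T = householder k u.
  by rewrite /householder linearB/= trmx1 linearZ/= trmx_mul trmxK.
rewrite /orthogonalmx sym {2}/householder mulmxBr mulmx1 -scalemxAr mulmxA.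
rewrite householderE mulmxBl -scalemxAl scalerBr scalerA mulrA kE.
rewrite /householder -addrA -opprD -scalerBl -scalerDl.
by rewrite [X in X *: _](_ : _ = 0) ?scale0r ?subr0//; ring.
Qed.

End householder.

(** * Completing the squares in a diagonal quadratic form *)

Lemma measurable_quadratic {R : realType} {n : nat} (w b : 'I_n -> R) (c : R) :
  measurable_fun setT
    (fun z : 'cV[R]_n => \sum_j (w j * z j 0 ^+ 2 + b j * z j 0) + c).
Proof.
apply: measurable_funD => //; apply: measurable_sum => j.
apply: measurable_funD; apply: measurable_funM => //.
  by apply: measurable_funX; exact: measurable_coord.
exact: measurable_coord.
Qed.

Lemma mvnormal_det_gt0 {d} {Omega : measurableType d} {R : realType}
    {P : probability Omega R} {n} {X : Omega -> 'cV[R]_n} {mu : 'cV[R]_n}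
    {S : 'M[R]_n} :
  mvnormal P X mu S -> S \in unitmx -> 0 < \det S.
Proof.
move=> [G <- _]; rewrite unitmxE unitfE det_mulmx det_tr -expr2 => detG.
by rewrite lt0r detG sqr_ge0.
Qed.

(* For sigma != 0, the reflection O fixes the coordinates of index in K and maps
   (0, bK) / sigma to the 0-th basis vector, so it turns the linear terms of index
   outside K into sigma v_0 without affecting the other terms. For sigma = 0 we
   have k = 0 and O is the identity. *)
Section quadratic_form.
Context {R : realType} {N : nat}.
Variables (w b : 'I_N -> R) (c : R).

Let K := [set j | w j != 0]%SET.
Let nu j := b j / (2 * w j).
Let sigma := Num.sqrt (\sum_(j | j \notin K) b j ^+ 2).
Let C := c - \sum_(j in K) w j * nu j ^+ 2.

Let tail (v : 'cV[R]_N.+1) : 'cV[R]_N := \col_i v (lift 0 i) 0.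
Let bK : 'cV[R]_N := \col_j (if j \in K then 0 else b j).
Let u : 'cV[R]_N.+1 := cV_cons (- sigma, bK).
(** Since [|bK|^2 = sigma^2], the vector [u] has squared norm [2 * sigma^2], so this is [2 / |u|^2].
    The convention that 0 has inverse 0 handles [sigma = 0]. *)
Let k := (sigma ^+ 2)^-1.
Let O := householder k u.

Let dot_cons x (v : 'cV[R]_N) (z : 'cV[R]_N.+1) :
  dot (cV_cons (x, v)) z = x * z 0 0 + dot v (tail z).
Proof.
rewrite !dotE big_ord_recl cV_cons0; congr (_ + _).
by apply: eq_bigr => i _; rewrite cV_consS mxE.
Qed.

Let tail_cons x (v : 'cV[R]_N) : tail (cV_cons (x, v)) = v.
Proof. by apply/colP => i; rewrite mxE cV_consS. Qed.

Let bKbK : dot bK bK = sigma ^+ 2.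
Proof.
rewrite sqr_sqrtr; last by apply: sumr_ge0 => j _; exact: sqr_ge0.
rewrite dotE [RHS]big_mkcond; apply: eq_bigr => j _; rewrite !mxE.
by case: ifP => _; rewrite ?mulr0 ?expr2.
Qed.

Let bK0 : sigma = 0 -> bK = 0.
Proof.
move=> s0; have := bKbK; rewrite s0 expr0n/= dotE => /eqP.
rewrite psumr_eq0 => [/allP H|i _]; last by rewrite -expr2 sqr_ge0.
apply/colP => i; rewrite [RHS]mxE; apply/eqP.
by have := H i (mem_index_enum _); rewrite mulf_eq0 orbb.
Qed.

Let O_orthogonal : orthogonalmx O.
Proof.
apply: householder_orthogonal; rewrite /u dot_cons cV_cons0 tail_cons bKbK /k.
by have [->|s0] := eqVneq sigma 0; [rewrite expr0n invr0 !(mul0r, mulr0)|field].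
Qed.

Let tailB x a z : tail (x - a *: z) = tail x - a *: tail z.
Proof. by apply/colP => i; rewrite !mxE. Qed.

Let tail_householder v : tail (O *m v) = tail v - (k * dot u v) *: bK.
Proof. by rewrite /O householderE tailB tail_cons. Qed.

Let dot_bK_O v : dot bK (tail (O *m v)) = sigma * v 0 0.
Proof.
rewrite tail_householder; have [s0|s0] := eqVneq sigma 0.
  by rewrite bK0// s0 mul0r /dot trmx0 mul0mx mxE.
rewrite dotDr dotNr {2}/dot -scalemxAr mxE -/(dot bK bK) bKbK /u dot_cons /k.
by field.
Qed.

Let tail_O v j : j \in K -> tail (O *m v) j 0 = v (lift 0 j) 0.
Proof.
by move=> jK; rewrite tail_householder !mxE jK mulr0 subr0.
Qed.

(** For [j] in [K] the reflection leaves the coordinate alone and the square is completed by [nu j].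
    For the other indices [w j = 0], and the linear terms sum to
    [<bK, tail (O v)> = sigma * v 0 0]. *)
Let completed_square v :
  \sum_j (w j * tail (O *m v) j 0 ^+ 2 + b j * tail (O *m v) j 0) + c =
  \sum_(j in K) w j * (v (lift 0 j) 0 + nu j) ^+ 2 + sigma * v 0 0 + C.
Proof.
have -> : sigma * v 0 0 = \sum_(j | j \notin K) b j * tail (O *m v) j 0.
  rewrite -dot_bK_O dotE [RHS]big_mkcond; apply: eq_bigr => j _.
  by rewrite mxE; case: ifP => _; rewrite ?mul0r.
rewrite (bigID (mem K))/= /C.
rewrite (eq_bigr (fun j => w j * (v (lift 0 j) 0 + nu j) ^+ 2 - w j * nu j ^+ 2)).
  rewrite sumrB; set s := \sum_(j | j \notin K) _.
  have -> : s = \sum_(j | j \notin K) b j * tail (O *m v) j 0.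
    by apply: eq_bigr => j; rewrite inE negbK => /eqP ->; rewrite mul0r add0r.
  by ring.
move=> j jK; rewrite tail_O// /nu.
by move: jK; rewrite inE => wj; field.
Qed.

Lemma generalized_chi2_quadratic d (Omega : measurableType d)
    (P : probability Omega R) (X : Omega -> R) :
  (forall A, measurable A -> P (X @^-1` A) = std_normal_cV
    [set z : 'cV[R]_N | A (\sum_j (w j * z j 0 ^+ 2 + b j * z j 0) + c)]) ->
  generalized_chi2 P X K w nu sigma C.
Proof.
(* One dimension is added: coordinate 0 carries [Z] and coordinate [lift 0 j] carries [Q j], so that
   [Z] is independent of all the [Q j], even when [K] contains every index. *)
move=> PX; pose P' : probability 'cV[R]_N.+1 R := @std_normal_cV R N.+1.
have mQ j : measurable_fun setT
    (fun v : 'cV[R]_N.+1 => (v (lift 0 j) 0 + nu j) ^+ 2).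
  apply: measurable_funX; apply: measurable_funD => //.
  exact: measurable_coord.
have mZ : measurable_fun setT (fun v : 'cV[R]_N.+1 => v 0 0).
  exact: measurable_coord.
pose Q j : {RV P' >-> R} := HB.pack
  (fun v : 'cV[R]_N.+1 => (v (lift 0 j) 0 + nu j) ^+ 2)
  (isMeasurableFun.Build _ _ _ _ _ (mQ j)).
pose Z : {RV P' >-> R} := HB.pack (fun v : 'cV[R]_N.+1 => v 0 0)
  (isMeasurableFun.Build _ _ _ _ _ mZ).
have msq j (A : set R) : measurable A ->
    measurable [set x : R | A ((x + nu j) ^+ 2)].
  move=> mA; rewrite -[X in measurable X]setTI.
  have mf : measurable_fun setT (fun x : R => (x + nu j) ^+ 2).
    by apply: measurable_funX; exact: measurable_funD.
  exact: mf.
exists _, 'cV[R]_N.+1, P', Q, Z; split.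
- move=> j _ A mA.
  exact: (std_normal_cV_coord (lift 0 j) (msq j A mA)).
- by move=> A mA; exact: (std_normal_cV_coord 0 mA).
- pose f (i : option {j : 'I_N | j \in K}) : 'I_N.+1 :=
    if i is Some j then lift 0 (val j) else 0.
  apply: (@coordinates_independent R N.+1 _ f).
    move=> [i|] [j|] //=; first by move=> /lift_inj/val_inj ->.
  move=> [j|] E [A mA <-]; last by exists A.
  by exists [set x : R | A ((x + nu (val j)) ^+ 2)] => //; exact: msq.
- move=> A mA; rewrite PX//.
  pose B := [set z : 'cV[R]_N | A (\sum_j (w j * z j 0 ^+ 2 + b j * z j 0) + c)].
  have mtail : measurable_fun setT tail.
    apply: measurable_matrix => i j; under eq_fun do rewrite mxE.
    exact: measurable_coord.
  have mB : measurable [set v | B (tail v)].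
    rewrite -[X in measurable X]setTI.
    exact: (measurableT_comp (measurable_quadratic w b c) mtail).
  (* The polynomial is first viewed as a function of the tail of a vector with one more coordinate,
     then composed with [O]. *)
  rewrite -(std_normal_cV_tail B) -(std_normal_cV_rotation O_orthogonal mB).
  by congr std_normal_cV; apply/seteqP; split => v; rewrite /= /B /= completed_square.
Qed.

End quadratic_form.

(** * The generalized chi-squared law under each hypothesis *)

Theorem theorem3 (R : realType) (n p q T : nat)
  (A : 'M[R]_n) (B : 'M[R]_(n, q)) (C : 'M[R]_(p, n)) (K0 K1 : 'M[R]_(q, n))
  (mu_w mu_0 : 'cV[R]_n) (Sigma_w Sigma_0 : 'M[R]_n) (Sigma_e : 'M[R]_p)
  (d : measure_display) (Omega : measurableType d)
  (P0 P1 : probability Omega R)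
  (x w : nat -> {mfun Omega >-> 'cV[R]_n}) (u : nat -> {mfun Omega >-> 'cV[R]_q})
  (y eps : nat -> {mfun Omega >-> 'cV[R]_p})
  (L0 L1 : 'cV[R]_(\sum_(s < T) p) -> R)
  (Q0 Q1 Psi0 Psi1 : 'M[R]_(\sum_(s < T) p))
  (lam lamb : 'rV[R]_(\sum_(s < T) p)) :
  let M0 := out_mean T C (A + B *m K0) mu_w mu_0 in
  let M1 := out_mean T C (A + B *m K1) mu_w mu_0 in
  let S0 := out_cov T C (A + B *m K0) Sigma_w Sigma_0 Sigma_e in
  let S1 := out_cov T C (A + B *m K1) Sigma_w Sigma_0 Sigma_e in
  let Y := stacked_outputs T y in
  let LLR := fun t => ln (L1 (Y t)) - ln (L0 (Y t)) in
  let D := M1 - M0 in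
  let wt j := (1 - lam 0 j) / 2 in
  let wtb j := (lamb 0 j - 1) / 2 in
  let KK0 := [set j | wt j != 0]%SET in
  let KK1 := [set j | wtb j != 0]%SET in
  let b0 := Psi0^T *m Q0 *m invmx S1 *m D in
  let b1 := Psi1^T *m Q1 *m invmx S0 *m D in
  let nu j := b0 j 0 / (2 * wt j) in
  let nub j := b1 j 0 / (2 * wtb j) in
  let sigma0 := Num.sqrt (\sum_(j | j \notin KK0) b0 j 0 ^+ 2) in
  let sigma1 := Num.sqrt (\sum_(j | j \notin KK1) b1 j 0 ^+ 2) in
  let C0 := (ln (\det S0 / \det S1) - (D^T *m invmx S1 *m D) 0 0) / 2
            - \sum_(j in KK0) wt j * nu j ^+ 2 in
  let C1 := (ln (\det S0 / \det S1) + (D^T *m invmx S0 *m D) 0 0) / 2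
            - \sum_(j in KK1) wtb j * nub j ^+ 2 in
  (1 <= T)%N ->
  psdmx Sigma_w -> psdmx Sigma_e -> psdmx Sigma_0 ->
  schur_stable (A + B *m K0) -> schur_stable (A + B *m K1) ->
  closed_loop P0 x u y w eps A B C K0
    mu_w Sigma_w Sigma_e mu_0 Sigma_0 ->
  closed_loop P1 x u y w eps A B C K1
    mu_w Sigma_w Sigma_e mu_0 Sigma_0 ->
  S0 \in unitmx -> S1 \in unitmx ->
  mvnormal P0 Y M0 S0 -> mvnormal P1 Y M1 S1 ->
  density_of P0 Y L0 -> density_of P1 Y L1 ->
  psd_sqrt_of S0 Q0 -> psd_sqrt_of S1 Q1 ->
  eigendecomposition (Q0 *m invmx S1 *m Q0) Psi0 lam ->
  eigendecomposition (Q1 *m invmx S0 *m Q1) Psi1 lamb ->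
  generalized_chi2 P0 LLR KK0 wt nu sigma0 C0 /\
  generalized_chi2 P1 LLR KK1 wtb nub sigma1 C1.
Proof.
move=> M0 M1 S0 S1 Y LLR D wt wtb KK0 KK1 b0 b1 nu nub sigma0 sigma1 C0 C1.
move=> _ _ _ _ _ _ _ _ uS0 uS1 Y0 Y1 YL0 YL1 sQ0 sQ1 e0 e1; split.
  apply: (generalized_chi2_quadratic (c := (ln (\det S0 / \det S1)
    - (D^T *m invmx S1 *m D) 0 0) / 2)) => A' mA'.
  exact: (log_likelihood_ratio_law uS0 uS1 Y0 Y1 YL0 YL1 sQ0 e0 mA').
apply: (generalized_chi2_quadratic (c := (ln (\det S0 / \det S1)
  + (D^T *m invmx S0 *m D) 0 0) / 2)) => A' mA'.
(* Exchanging the two laws yields the law of [- LLR] under [P1], hence the reflected set. *)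
have mA'N : measurable [set x | A' (- x)].
  by rewrite -[X in measurable X]setTI; apply: measurable_funN.
have := log_likelihood_ratio_law uS1 uS0 Y1 Y0 YL1 YL0 sQ1 e1 mA'N.
rewrite (_ : [set t | _] = LLR @^-1` A'); last first.
  by apply/seteqP; split => t; rewrite /= opprB.
move=> ->; congr std_normal_cV.
(* The exchange replaces [D] by [- D] and inverts the determinant ratio. The overall sign turns
   [(1 - lamb 0 j) / 2] into [wtb j] and restores [b1], while the form in [D] is even and only
   changes sign as a whole. *)
have quadE (z : 'cV[R]_(\sum_(s < T) p)) :
    - (\sum_j ((1 - lamb 0 j) / 2 * z j 0 ^+ 2
              + (Psi1^T *m Q1 *m invmx S0 *m (M0 - M1)) j 0 * z j 0)
       + (ln (\det S1 / \det S0)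
          - ((M0 - M1)^T *m invmx S0 *m (M0 - M1)) 0 0) / 2) =
    \sum_j (wtb j * z j 0 ^+ 2 + b1 j 0 * z j 0)
    + (ln (\det S0 / \det S1) + (D^T *m invmx S0 *m D) 0 0) / 2.
  have DN : (- D)^T *m invmx S0 *m (- D) = D^T *m invmx S0 *m D.
    by rewrite mulmxN [(- D)^T]linearN /= !mulNmx opprK.
  rewrite -(opprB M1 M0) -/D DN mulmxN -/b1.
  (* The rule for [ln] of an inverse needs a positive argument; both determinants are squares of
     nonzero numbers. *)
  rewrite -(invf_div (\det S0) (\det S1)) lnV ?posrE; last first.
    by rewrite divr_gt0// (mvnormal_det_gt0 Y0, mvnormal_det_gt0 Y1).
  rewrite opprD -sumrN; congr (_ + _); last by field.
  by apply: eq_bigr => j _; rewrite [(- b1) j 0]mxE /wtb; field.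
by apply/seteqP; split => z; rewrite /mkset quadE.
Qed.
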